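(* Let $c\in\mathbb R$ and assume that $f\in\mathbb L^2_{\mathbb R_+}(x^{2c-1})$, $\Psi\,\mathcal M_c[f]\in\mathbb L^1_{\mathbb R}$, $\sigma:=\mathbb E_f(X_1^{2(c-1)})<\infty$ and $\|g\|_{\infty,x^{2c-1}}<\infty$. Suppose that one of the following cases holds: (i) $\Psi$ is smooth (with exponent $p$) and $g$ is smooth (with exponent $\gamma$), and $2p-2\gamma>1$; (ii) $\Psi$ is super smooth and $g$ is smooth; (iii) $\Psi$ is super smooth (with parameters $p,\mu,R$) and $g$ is super smooth (with parameters $\gamma,\lambda,\rho$), and either $R>\rho$, or ($R=\rho$ and $\mu>\lambda$), or ($R=\rho$, $\mu=\lambda$ and $2p-2\gamma>1$). Then $\sup_{k\in\mathbb R_+}\Delta_{\Psi,g}(k)<\infty$. Furthermore, there is a constant $C(\Psi,g,\sigma)>0$, depending on $\Psi$, $g$ and $\sigma$, such that for every $n\in\mathbb N$ and all sufficiently large $k\in\mathbb R_+$ (the threshold may depend on $n$), $$\mathbb E^n_{f_Y}\big((\widehat\vartheta_k-\vartheta(f))^2\big)\le\frac{C(\Psi,g,\sigma)}{n}.$$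
   Context: Notation: $\mathbb R_+=(0,\infty)$. For $p\ge1$ and $a\in\mathbb R$, $\mathbb L^p_{\mathbb R_+}(x^a)$ is the space of measurable $h:\mathbb R_+\to\mathbb C$ with $\int_0^\infty|h(x)|^px^a\,dx<\infty$; $\mathbb L^p_{\mathbb R}$ is the usual (unweighted) space on $\mathbb R$. $\|g\|_{\infty,x^{2c-1}}$ is the essential supremum over $x\in\mathbb R_+$ of $x^{2c-1}g(x)$. Model: $X$ and $U$ are independent positive random variables with Lebesgue densities $f$ and $g$ on $\mathbb R_+$, $g$ known. $Y=XU$ has density $f_Y(y)=\int_0^\infty f(x)g(y/x)x^{-1}dx$. One observes i.i.d. $Y_1,\dots,Y_n$ with density $f_Y$. $\mathbb E^n_{f_Y}$ is expectation with respect to the law of $(Y_1,\dots,Y_n)$, and $\mathbb E_f$ denotes expectation when $X_1$ has density $f$. Mellin transform: for $h\in\mathbb L^1_{\mathbb R_+}(x^{c-1})$, $\mathcal M_c[h](t)=\int_0^\infty x^{c-1+it}h(x)\,dx$, $t\in\mathbb R$. Standing assumptions: $f,g\in\mathbb L^1_{\mathbb R_+}(x^{c-1})$; $\mathcal M_c[g](t)\ne0$ for all $t\in\mathbb R$; $\Psi:\mathbb R\to\mathbb C$ is a known measurable function with $\overline{\Psi(t)}=\Psi(-t)$ for all $t$. Linear functional and estimator: $$\vartheta(f)=\frac1{2\pi}\int_{-\infty}^\infty\Psi(-t)\mathcal M_c[f](t)\,dt,\qquad \widehat\vartheta_k=\frac1{2\pi}\int_{-k}^k\Psi(-t)\frac{\widehat{\mathcal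 M}_c(t)}{\mathcal M_c[g](t)}\,dt,\qquad \widehat{\mathcal M}_c(t)=\frac1n\sum_{j=1}^nY_j^{c-1+it},$$ and $\Delta_{\Psi,g}(k)=\frac1{2\pi}\int_{-k}^k|\Psi(t)/\mathcal M_c[g](t)|^2dt$. Smoothness classes (all inequalities for all $t\in\mathbb R$): - $g$ is smooth if there are $\gamma,c_{g,c},C_{g,c}>0$ with $c_{g,c}(1+t^2)^{-\gamma/2}\le|\mathcal M_c[g](t)|\le C_{g,c}(1+t^2)^{-\gamma/2}$. - $g$ is super smooth if there are $\lambda,\rho,c_{g,c},C_{g,c}>0$ and $\gamma\in\mathbb R$ with $c_{g,c}(1+t^2)^{-\gamma/2}e^{-\lambda|t|^\rho}\le|\mathcal M_c[g](t)|\le C_{g,c}(1+t^2)^{-\gamma/2}e^{-\lambda|t|^\rho}$. - $\Psi$ is smooth if there are $c_{\Psi,c},C_{\Psi,c}>0$ and $p\ge0$ with $c_{\Psi,c}(1+t^2)^{-p/2}\le|\Psi(t)|\le C_{\Psi,c}(1+t^2)^{-p/2}$. - $\Psi$ is super smooth if there are $\mu,R,c_{\Psi,c},C_{\Psi,c}>0$ and $p\in\mathbb R$ with $c_{\Psi,c}(1+t^2)^{-p/2}e^{-\mu|t|^R}\le|\Psi(t)|\le C_{\Psi,c}(1+t^2)^{-p/2}e^{-\mu|t|^R}$. *)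

(* Defs.v *)
From HB Require Import structures.
From mathcomp Require Import all_boot all_order all_algebra.
From mathcomp Require Import complex.
From mathcomp Require Import all_classical all_reals all_analysis ess_sup_inf.

Set Implicit Arguments.
Unset Strict Implicit.
Unset Printing Implicit Defensive.

Import Order.TTheory GRing.Theory Num.Theory.
Import numFieldNormedType.Exports.

Local Open Scope classical_set_scope.
Local Open Scope ring_scope.

Section ComplexAnalysis.
Context {R : realType}.
Local Notation mu := (@lebesgue_measure R).

Definition Rpos : set R := `]0%R, +oo[%classic.

Definition cmeasurable (D : set R) (h : R -> R[i]) : Prop :=
  measurable_fun D (fun x => complex.Re (h x)) /\
  measurable_fun D (fun x => complex.Im (h x)).

(* Integral of a complex-valued function, meaningful when [Normc.normc \o h] is
   integrable on [D]. *)
Definition cintegral (D : set R) (h : R -> R[i]) : R[i] :=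
  Complex (Rintegral mu D (fun x => complex.Re (h x)))
          (Rintegral mu D (fun x => complex.Im (h x))).

Definition wLp (p a : R) (h : R -> R[i]) : Prop :=
  cmeasurable Rpos h /\
  (\int[mu]_(x in Rpos) (Normc.normc (h x) `^ p * x `^ a)%:E < +oo)%E.

Definition Lp_real_line (p : R) (h : R -> R[i]) : Prop :=
  cmeasurable setT h /\ (\int[mu]_x (Normc.normc (h x) `^ p)%:E < +oo)%E.

(* x ^ (a + i t) for x > 0. *)
Definition cpower (x a t : R) : R[i] :=
  Complex (x `^ a * cos (t * ln x)) (x `^ a * sin (t * ln x)).

Definition mellin (c : R) (h : R -> R[i]) (t : R) : R[i] :=
  cintegral Rpos (fun x => cpower x (c - 1) t * h x).

End ComplexAnalysis.

Section Model.
Context {R : realType}.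
Local Notation mu := (@lebesgue_measure R).

(* [f x] for [x <= 0] is irrelevant throughout. *)
Definition density (f : R -> R) : Prop :=
  [/\ measurable_fun Rpos f,
      (forall x, 0 < x -> 0 <= f x) &
      (\int[mu]_(x in Rpos) (f x)%:E = 1)%E].

Definition cfun (f : R -> R) : R -> R[i] := fun x => Complex (f x) 0.

(* Expectation of [h X] when [X] has density [f], for [h >= 0]. *)
Definition expect_density (f h : R -> R) : \bar R :=
  (\int[mu]_(x in Rpos) (h x * f x)%:E)%E.

Lemma measurable_Rpos : measurable (@Rpos R).
Proof. exact: measurable_itv. Qed.

Definition weighted_ess_sup (a : R) (g : R -> R) : \bar R :=
  ess_sup (mrestr mu measurable_Rpos) (fun x => (x `^ a * g x)%:E).

(* Density of the product of independent variables with densities [f], [g]. *)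
Definition mult_conv (f g : R -> R) (y : R) : \bar R :=
  (\int[mu]_(x in Rpos) (f x * g (y / x) * x^-1)%:E)%E.

Definition has_density (d : measure_display) (Omega : measurableType d)
    (P : probability Omega R) (Y : {RV P >-> R}) (h : R -> \bar R) : Prop :=
  forall A : set R, measurable A ->
    distribution P Y A = (\int[mu]_(y in A `&` Rpos) h y)%E.

(* Since some of the [A i] may be the whole line, the product rule for the full
   family implies it for every subfamily. *)
Definition mutually_independent (d : measure_display)
    (Omega : measurableType d) (P : probability Omega R) (n : nat)
    (Y : 'I_n -> {RV P >-> R}) : Prop :=
  forall A : 'I_n -> set R, (forall i, measurable (A i)) ->
    P (\bigcap_(i in [set: 'I_n]) (Y i @^-1` A i)) =
    (\prod_(i < n) P (Y i @^-1` A i))%E.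

Definition iid_with_density (d : measure_display)
    (Omega : measurableType d) (P : probability Omega R) (n : nat)
    (Y : 'I_n -> {RV P >-> R}) (h : R -> \bar R) : Prop :=
  mutually_independent Y /\ forall i, has_density (Y i) h.

Definition theta (c : R) (Psi : R -> R[i]) (f : R -> R) : R[i] :=
  Complex (2 * pi)^-1 0 *
  cintegral setT (fun t => Psi (- t) * mellin c (cfun f) t).

Definition empirical_mellin (c : R) (n : nat) (y : 'I_n -> R) (t : R) : R[i] :=
  n%:R^-1 * \sum_(j < n) cpower (y j) (c - 1) t.

Definition theta_hat (c : R) (Psi : R -> R[i]) (g : R -> R) (k : R)
    (n : nat) (y : 'I_n -> R) : R[i] :=
  Complex (2 * pi)^-1 0 *
  cintegral `[- k, k]%classic
    (fun t => Psi (- t) * (empirical_mellin c y t / mellin c (cfun g) t)).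

Definition Delta (c : R) (Psi : R -> R[i]) (g : R -> R) (k : R) : \bar R :=
  (((2 * pi)^-1)%:E *
   \int[mu]_(t in `[(- k)%R, k]) (Normc.normc (Psi t / mellin c (cfun g) t) ^+ 2)%:E)%E.

Definition two_sided_bound (phi : R -> R[i]) (env : R -> R) : Prop :=
  exists c C : R, [/\ 0 < c, 0 < C &
    forall t, c * env t <= Normc.normc (phi t) <= C * env t].

Definition poly_decay (a t : R) : R := (1 + t ^+ 2) `^ (- a / 2).

Definition exp_decay (a l r t : R) : R :=
  poly_decay a t * expR (- l * `|t| `^ r).

Definition smooth_error (c : R) (g : R -> R) (gamma : R) : Prop :=
  0 < gamma /\ two_sided_bound (mellin c (cfun g)) (poly_decay gamma).

Definition super_smooth_error (c : R) (g : R -> R) (gamma lambda rho : R) :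
    Prop :=
  [/\ 0 < lambda, 0 < rho &
      two_sided_bound (mellin c (cfun g)) (exp_decay gamma lambda rho)].

Definition smooth_functional (Psi : R -> R[i]) (p : R) : Prop :=
  0 <= p /\ two_sided_bound Psi (poly_decay p).

Definition super_smooth_functional (Psi : R -> R[i]) (p m r : R) : Prop :=
  [/\ 0 < m, 0 < r & two_sided_bound Psi (exp_decay p m r)].

End Model.

(* Main.v *)
(* The statistic [theta_hat] is an average of n independent copies of
   Z(Y) = (2 pi)^-1 int_{-k}^k phi(t) Y^(c-1+it) dt with
   phi(t) = Psi(-t) / M_c[g](t), so its risk is at most E|Z(Y)|^2 / n plus the
   squared bias.  As M_c[f_Y] = M_c[f] M_c[g], the bias is the tail
   int_{|t|>k} Psi(-t) M_c[f](t) dt, which vanishes as k grows.  Conditioning on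
   X and using z^(2c-1) g(z) <= G almost everywhere, the substitution y = e^u
   gives E|Z(Y)|^2 <= C G sigma int |H(u)|^2 du, where H is the Fourier integral
   of phi 1_[-k,k]; Plancherel's inequality bounds this by int |phi|^2, which is
   finite because in each case |phi(t)|^2 <= K (1 + t^2)^(-q/2) for some q > 1.

   Plancherel's inequality is obtained by weighting with e^(-e|u|): then
   int e^(-e|u|) |H(u)|^2 du is the quadratic form of the Poisson kernel, of
   total mass 2 pi, hence at most 2 pi int |phi|^2, and e tends to 0. *)

Require Import Defs.
From HB Require Import structures.
From mathcomp Require Import all_boot all_order all_algebra.
From mathcomp Require Import complex.
From mathcomp Require Import all_classical all_reals all_analysis ess_sup_inf.
From mathcomp Require Import measurable_realfun ring lra.

Set Implicit Arguments.
Unset Strict Implicit.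
Unset Printing Implicit Defensive.

Import Order.TTheory GRing.Theory Num.Theory.
Import numFieldNormedType.Exports.

Local Open Scope classical_set_scope.
Local Open Scope ring_scope.

(* The measure structure of [pushforward m f] depends on a proof that [f] is
   measurable, so it cannot be inferred. *)
Local Notation pushforward_measure :=
  measure_function_pushforward__canonical__measure_function_Measure.

(** * Measures with a density, changes of variables *)

(** Complex-valued random variables are avoided. With [phi t = Psi (- t) / M_c[g] t], the real and
    imaginary parts of the statistic are both averages of [spectral_stat c a b], for
    [(a, b) = (Re phi, - Im phi)] and [(Im phi, Re phi)] cut to [[-k, k]]; one risk bound serves for
    both.

    The constant may not depend on [k], although the integrals do. Second moments are therefore
    compared with [int |phi|^2] over the whole line, while the cut to [[-k, k]] supplies absolute
    integrability: a square integrable function on a bounded interval is integrable, and this is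
    what the transforms and every exchange of integrals rest on.

    Plancherel is needed as an inequality only. The weight is there because exchanging the integrals
    in [t], [s] and [u] requires an absolutely integrable integrand, and [a(t) a(s) cos((t - s) u)]
    does not decay in [u].

    The law of [Y] is handled as the image of [f(x) g(z) dx dz] under [(x, z) -> x z]. There powers
    factor and logarithms add, which gives both the product formula for Mellin transforms and the
    separation of [X] from the noise in the second moment. *)

Section density_measure.
Local Open Scope ereal_scope.
Context d (T : measurableType d) (R : realType) (m : {measure set T -> \bar R}).
Context (q : T -> \bar R) (mq : measurable_fun setT q) (q0 : forall x, 0 <= q x).

(* The proofs are arguments so that the measure structure can be inferred. *)
Definition density_measure of measurable_fun setT q & (forall x, 0 <= q x) :=
  fun A : set T => \int[m]_(x in A) q x.

Local Notation nu := (density_measure mq q0).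

Let nu0 : nu set0 = 0. Proof. exact: integral_set0. Qed.

Let nu_ge0 A : 0 <= nu A. Proof. exact: integral_ge0. Qed.

Let nu_sigma_additive : semi_sigma_additive nu.
Proof.
move=> A mA tA mUA; rewrite /density_measure ge0_integral_bigcup//.
  by apply: is_cvg_ereal_nneg_natsum_cond => n _ _; exact: integral_ge0.
exact: measurable_funTS.
Qed.

HB.instance Definition _ := isMeasure.Build _ _ _ nu
  nu0 nu_ge0 nu_sigma_additive.

Import HBNNSimple.

(** On indicators this is the definition of [density_measure]; linearity extends it to simple
    functions and monotone convergence, applied on both sides, to [h]. *)
Lemma integral_density_measure (h : T -> \bar R) :
  measurable_fun setT h -> (forall x, 0 <= h x) ->
  \int[nu]_x h x = \int[m]_x (h x * q x).
Proof.
move=> mh h0; pose h_ := nnsfun_approx measurableT mh.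
have h_cvg x : EFin \o h_^~ x @ \oo --> h x by exact: cvg_nnsfun_approx.
have nd_h x : nondecreasing_seq (fun n => (h_ n x)%:E).
  move=> a b ab; rewrite lee_fin.
  by have /lefP/(_ x) := nd_nnsfun_approx measurableT mh ab.
transitivity (limn (fun n => \int[nu]_x (h_ n x)%:E)).
  rewrite -monotone_convergence//.
  - by apply: eq_integral => x _; apply/esym/cvg_lim => //; exact: h_cvg.
  - by move=> n; exact/measurable_EFinP.
  - by move=> n x _; rewrite lee_fin.
transitivity (limn (fun n => \int[m]_x ((h_ n x)%:E * q x))); last first.
  rewrite -monotone_convergence//.
  - apply: eq_integral => x _; apply/cvg_lim => //.
    (* The product may be [0 * +oo] in the limit. Where [h x = 0] the increasing nonnegative
       approximations vanish as well, so the sequence of products is constantly 0; where [q x] is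
       infinite, [h x] is nonzero and the product is continuous there. *)
    have [hx0|hx0] := eqVneq (h x) 0.
      rewrite hx0 mul0e [X in X @ _](_ : _ = cst 0); first exact: cvg_cst.
      apply/funext => n; have := h_cvg x; rewrite hx0 => hn.
      suff -> : (h_ n x)%:E = 0 by rewrite mul0e.
      apply/eqP; rewrite eq_le [X in _ && X]lee_fin fun_ge0 andbT.
      rewrite -(cvg_lim _ hn)// (cvg_lim _ (ereal_nondecreasing_cvgn (nd_h x)))//.
      by apply: ereal_sup_ubound; exists n.
    have [qf|qf] := boolP (q x \is a fin_num); first by apply: cvgeZr => //; exact: h_cvg.
    apply: (cvgeM _ (h_cvg x) (cvg_cst _)).
    exact: mule_def_neq0_infty.
  - by move=> n; apply: emeasurable_funM => //; exact/measurable_EFinP.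
  - by move=> n x _; rewrite mule_ge0// lee_fin.
  - by move=> x _ a b ab; rewrite lee_wpmul2r//; exact: nd_h.
congr (limn _); apply/funext => n.
under [LHS]eq_integral do rewrite fimfunE -fsumEFin//.
rewrite ge0_integral_fsum//; last 2 first.
  by move=> y; exact/measurable_EFinP/measurable_funM.
  by move=> y x _; rewrite EFinM nnfun_muleindic_ge0.
under [RHS]eq_integral.
  move=> x _; rewrite fimfunE -fsumEFin// ge0_mule_fsuml; last first.
    by move=> y; rewrite EFinM nnfun_muleindic_ge0.
  over.
rewrite [RHS]ge0_integral_fsum//; last 2 first.
  move=> y; apply: emeasurable_funM; last exact: mq.
  exact/measurable_EFinP/measurable_funM.
  by move=> y x _; rewrite mule_ge0// EFinM nnfun_muleindic_ge0.
apply: eq_fsbigr => y /[!inE] -[x _ hxy].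
under [LHS]eq_integral do rewrite EFinM.
rewrite ge0_integralZl//; last 2 first.
- exact/measurable_EFinP.
- by rewrite lee_fin -hxy.
under [RHS]eq_integral do rewrite EFinM -muleA.
rewrite [RHS]ge0_integralZl//; last 3 first.
- by apply: emeasurable_funM => //; exact/measurable_EFinP.
- by move=> z _; rewrite mule_ge0// lee_fin.
- by rewrite lee_fin -hxy.
congr (_ * _).
rewrite integral_indic// setIT /= /density_measure [LHS]integral_mkcond.
apply: eq_integral => z _; rewrite patchE indicE.
by case: ifPn => _; rewrite ?mul1e ?mul0e.
Qed.

End density_measure.

Section lebesgue_change_of_variables.
Local Open Scope ereal_scope.
Context {R : realType}.
Local Notation mu := (@lebesgue_measure R).

(** Uniqueness of Lebesgue measure: [x] times the image of [mu] under multiplication by [x] gives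
    every []a, b]] the mass [b - a]. *)
Lemma ge0_integral_scale (x : R) (F : R -> \bar R) : (0 < x)%R ->
  measurable_fun setT F -> (forall y, 0 <= F y) ->
  \int[mu]_y F y = x%:E * \int[mu]_z F (x * z)%R.
Proof.
move=> x0 mF F0.
pose sc : R -> measurableTypeR R := ( *%R x).
have msc : measurable_fun setT sc by exact: measurable_funM.
pose m : {measure set (measurableTypeR R) -> \bar R} :=
  mscale (NngNum (ltW x0)) (pushforward_measure mu msc).
transitivity (\int[m]_y F y).
  apply: eq_measure_integral => A mA _; apply: lebesgue_measure_unique => //.
  move=> _ [[a b]] _ <-; rewrite (_ : m _ = x%:E * mu (sc @^-1` `]a, b]%classic))//.
  have sc_ab : sc @^-1` `]a, b] = `](a / x)%R, (b / x)%R]%classic.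
    by apply/seteqP; split => z /=; rewrite !in_itv/= /sc ltr_pdivrMr// ler_pdivlMr// mulrC.
  rewrite sc_ab !lebesgue_measure_itv/= !lte_fin ltr_pM2r ?invr_gt0//.
  case: ifPn => _; last by rewrite mule0.
  by rewrite -!EFinB -EFinM -mulrBl mulrCA mulfV ?mulr1// gt_eqF.
rewrite /m ge0_integral_mscale//=.
by rewrite ge0_integral_pushforward// preimage_setT.
Qed.

End lebesgue_change_of_variables.

Section exponential_substitution.
Local Open Scope ereal_scope.
Context {R : realType}.
Local Notation mu := (@lebesgue_measure R).

Lemma integral_expR_ray (t : R) :
  \int[mu]_(u in `]-oo, t]) (expR u)%:E = (expR t)%:E.
Proof.
rewrite -[in LHS](opprK t) ge0_integration_by_substitutionNy; last 2 first.
- by apply: continuous_subspaceT; exact: continuous_expR.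
- by move=> x _; exact: expR_ge0.
rewrite (@ge0_continuous_FTC2y _ _ (fun v => - expR (- v))%R _ 0%R).
- by rewrite opprK add0r EFinN oppeK.
- by move=> x _ /=; exact: expR_ge0.
- apply: continuous_subspaceT => x.
  by apply: continuous_comp; [exact: continuousN|exact: continuous_expR].
- by rewrite -[X in _ --> X]oppr0; apply: cvgN; exact: cvgr_expR.
- by move=> x _.
- apply: cvgN; apply: cvg_at_right_filter.
  by apply: continuous_comp; [exact: continuousN|exact: continuous_expR].
- move=> x _; rewrite derive1E.
  by rewrite derive_val /= mulrN1 opprK.
Qed.

(** The image [m1] of [e^u du] under [expR] gives []0, b]] the mass [b] and ignores the nonpositive
    half-line. Uniqueness of Lebesgue measure speaks of the whole line, so [m1] is completed by
    [m2], Lebesgue measure on []-oo, 0]]; the sum is [mu], and the integral over []0, +oo[] sees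
    only [m1]. *)
Lemma ge0_integral_expR (F : R -> \bar R) :
  measurable_fun setT F -> (forall y, 0 <= F y) ->
  \int[mu]_(y in `]0%R, +oo[) F y = \int[mu]_u (F (expR u) * (expR u)%:E).
Proof.
move=> mF F0.
have mexp : measurable_fun setT (@expR R : R -> measurableTypeR R).
  exact: (@measurable_expR R).
have mE : measurable_fun setT (EFin \o @expR R).
  by apply/measurable_EFinP; exact: (@measurable_expR R).
have E0 (x : R) : 0 <= (EFin \o @expR R) x by rewrite lee_fin expR_ge0.
pose m1 := pushforward_measure (density_measure mu mE E0) mexp.
pose m2 := mrestr mu (measurable_itv `]-oo, 0%R]).
have m1E A : m1 A = \int[mu]_(u in expR @^-1` A) (expR u)%:E by [].
have m1_pos b : (0 < b)%R -> m1 `]0%R, b]%classic = b%:E.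
  move=> b0; rewrite m1E -[in RHS](lnK b0) -integral_expR_ray.
  congr (integral mu _ _); apply/seteqP; split => u /=; rewrite !in_itv/= expR_gt0/=.
    by move=> ub; rewrite -(expRK u) ler_ln ?posrE// ?expR_gt0.
  by move=> ub; rewrite -(lnK b0) ler_expR.
have m1_gt0 a b : (0 <= a)%R -> (a < b)%R -> m1 `]a, b]%classic = (b - a)%:E.
  rewrite le_eqVlt => /predU1P[<- b0|a0 ab]; first by rewrite m1_pos ?subr0.
  have -> : `]a, b]%classic = `]0%R, b]%classic `\` `]0%R, a]%classic.
    apply/seteqP; split => u /=; rewrite !in_itv/=.
      by move=> /andP[au ub]; rewrite (lt_trans a0 au) ub leNgt au.
    by move=> [/andP[u0 ub]]; rewrite u0 ub andbT /= => /negP; rewrite -ltNge.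
  rewrite measureD//=; last by rewrite m1_pos ?ltry// (lt_trans a0).
  rewrite setIidr.
    by rewrite !m1_pos// (lt_trans a0).
  by apply: subset_itvl; rewrite bnd_simp ltW.
have m1_le0 A : A `<=` `]-oo, 0%R]%classic -> m1 A = 0.
  move=> A0; rewrite m1E (_ : _ @^-1` _ = set0) ?integral_set0//.
  apply/seteqP; split => u //= /A0 /=; rewrite in_itv/=.
  by rewrite leNgt expR_gt0.
have addE A : measure_add m1 m2 A = m1 A + mu (A `&` `]-oo, 0%R]%classic).
  by rewrite measure_addE.
have lebE A : measurable A -> mu A = measure_add m1 m2 A.
  apply: lebesgue_measure_unique => _ [[a b]] _ <-.
  apply: etrans _ (esym (addE _)).
  have [ba|ab] := leP b a.
    by rewrite set_itv_ge ?bnd_simp -?leNgt// set0I !measure0 adde0.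
  have [b0|b0] := leP b 0%R.
    rewrite m1_le0 ?add0e ?setIidl//;
      by move=> u /=; rewrite !in_itv/= => /andP[_ /le_trans]; exact.
  have [a0|a0] := ltP a 0%R; last first.
    rewrite m1_gt0// (_ : _ `&` _ = set0) ?measure0 ?adde0.
      by rewrite lebesgue_measure_itv/= lte_fin ab EFinB.
    apply/seteqP; split => u //= []; rewrite !in_itv/= => /andP[au _].
    by rewrite leNgt (le_lt_trans a0).
  have -> : `]a, b]%classic `&` `]-oo, 0%R]%classic = `]a, 0%R]%classic.
    apply/seteqP; split => u /=; rewrite !in_itv/=.
      by move=> [/andP[-> _] ->].
    by move=> /andP[-> u0]; rewrite u0 (le_trans u0 (ltW b0)).
  have abE : `]a, b]%classic = `]a, 0%R]%classic `|` `]0%R, b]%classic.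
    by rewrite -itv_bndbnd_setU ?bnd_simp// ltW.
  have m1ab : m1 `]a, b]%classic = b%:E.
    transitivity (m1 `]a, 0%R]%classic + m1 `]0%R, b]%classic).
      rewrite abE; apply: measureU => //.
      apply/seteqP; split => u //= []; rewrite !in_itv/= => /andP[_ u0].
      by rewrite ltNge u0.
    rewrite m1_pos// [X in X + _]m1_le0 ?add0e//.
    by move=> u /=; rewrite !in_itv/= => /andP[].
  by rewrite m1ab !lebesgue_measure_itv/= !lte_fin a0 ab -EFinD add0r.
transitivity (\int[m1]_(y in `]0%R, +oo[) F y).
  apply: eq_measure_integral => A mA A0; rewrite [LHS]lebE// addE.
  rewrite [X in _ + X](_ : _ = 0) ?adde0//.
  rewrite (_ : A `&` _ = set0) ?measure0//.
  apply/seteqP; split => u //= [/A0/=]; rewrite !in_itv/= andbT.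
  by rewrite leNgt => ->.
rewrite ge0_integral_pushforward//; last exact: measurable_funTS.
rewrite (_ : _ @^-1` _ = setT); last first.
  by apply/seteqP; split => u //= _; rewrite in_itv/= expR_gt0.
by rewrite integral_density_measure//=; exact: measurableT_comp.
Qed.

End exponential_substitution.

(** * Plancherel's inequality *)

Section poisson_kernel.
Context {R : realType}.
Local Notation mu := (@lebesgue_measure R).

Lemma oneDcos_ge0 (x : R) : 0 <= 1 + cos x.
Proof. by rewrite addrC -lerBlDr sub0r cos_geN1. Qed.

(** The affine substitution [(s - t) / e] turns the kernel into [1 / (1 + x^2)], whose integral over
    the line is [pi]. *)
Lemma integral_poisson_kernel (e t : R) : 0 < e ->
  (\int[mu]_s (e / (e ^+ 2 + (t - s) ^+ 2))%:E = pi%:E)%E.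
Proof.
move=> e0.
have piE : (\int[mu]_x ((@oneDsqr R x)^-1)%:E = pi%:E)%E.
  rewrite ge0_symfun_integralT; last 3 first.
  - by move=> x; rewrite invr_ge0 (le_trans ler01)// oneDsqr_ge1.
  - exact: continuous_oneDsqrV.
  - by move=> x /=; rewrite /oneDsqr sqrrN.
  rewrite -set_itvcy integral0y_oneDsqr -EFinM; congr EFin.
  by field.
pose F (s : R) := (s - t) / e.
have dF (s : R) : is_derive s 1 F e^-1.
  rewrite /F; apply: is_derive_eq.
  by rewrite scaler0 add0r subr0 scaler1.
have F'E : F^`()%classic = cst e^-1 by apply/funext => s; rewrite derive1E derive_val.
rewrite -piE [RHS](@increasing_ge0_integration_by_substitutionT _ F).
- apply: eq_integral => s _; rewrite F'E /F /oneDsqr/=; congr EFin.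
  rewrite !fctE; field.
  rewrite gt_eqF//= gt_eqF// ?ltr_pwDl ?exprn_gt0// ?sqr_ge0//.
- by move=> x y xy; rewrite /F ltr_pM2r ?invr_gt0// ltrD2r.
- by rewrite F'E => ?; exact: cvg_cst.
- by rewrite F'E; exact: is_cvg_cst.
- by rewrite F'E; exact: is_cvg_cst.
- by move=> x; case: (dF x).
- apply: gt0_cvgMlNy; last exact: cvg_addrr_Ny.
  by rewrite invr_gt0.
- apply: gt0_cvgMly; last exact: cvg_addrr.
  by rewrite invr_gt0.
- exact: continuous_oneDsqrV.
- by move=> x; rewrite invr_ge0 (le_trans ler01)// oneDsqr_ge1.
Qed.

(** [1 + cos] replaces [cos] so that the integrand is nonnegative, as the fundamental theorem on a
    half-line used here demands. *)
Lemma integral_expR_1Dcos_ray (e x : R) : 0 < e ->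
  (\int[mu]_(u in `[0%R, +oo[) (expR (- (e * u)) * (1 + cos (x * u)))%:E =
   (e^-1 + e / (e ^+ 2 + x ^+ 2))%:E)%E.
Proof.
move=> e0; set D := e ^+ 2 + x ^+ 2.
have D0 : D != 0 by rewrite gt_eqF// /D ltr_pwDl ?exprn_gt0// sqr_ge0.
pose E u := expR (- (e * u)).
have dE (u : R) : is_derive u 1 E (- e * E u).
  apply: is_derive_eq.
  by rewrite /GRing.scale/= /E; ring.
(* The second summand is the real part of [e^((-e + i x) u) / (-e + i x)], a primitive of
   [e^(-e u) cos (x u)]. *)
pose F u := E u * (- e^-1 + (x * sin (x * u) - e * cos (x * u)) / D).
have dF (u : R) : is_derive u 1 F (E u * (1 + cos (x * u))).
  apply: is_derive_eq; rewrite /GRing.scale/= /D; field.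
  by rewrite -/D D0 gt_eqF.
have cE : continuous E.
  move=> u; apply: continuous_comp; last exact: continuous_expR.
  by apply: continuousN; exact: mulrl_continuous.
have ccos : continuous (fun u => cos (x * u)).
  by move=> u; apply: continuous_comp; [exact: mulrl_continuous|exact: continuous_cos].
rewrite (@ge0_continuous_FTC2y _ _ F _ 0).
- rewrite -EFinB /F /E !mulr0 oppr0 expR0 sin0 cos0; congr EFin; rewrite /D; field.
  by rewrite -/D D0 gt_eqF.
- by move=> u _; rewrite mulr_ge0 ?expR_ge0 ?oneDcos_ge0.
- apply: continuous_subspaceT => u; apply: cvgM; first exact: cE.
  by apply: cvgD; [exact: cvg_cst|exact: ccos].
- apply/norm_cvg0P.
  pose K := e^-1 + (`|x| + e) / `|D|.
  apply: (@squeeze_cvgr _ _ _ _ (cst 0) (fun u => E u * K)).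
  + apply: nearW => u; rewrite normr_ge0/= normrM ger0_norm ?expR_ge0// ler_wpM2l ?expR_ge0//.
    rewrite (le_trans (ler_normD _ _))// lerD//.
      by rewrite normrN ger0_norm// invr_ge0 ltW.
    rewrite normrM normfV ler_wpM2r ?invr_ge0//.
    rewrite (le_trans (ler_normB _ _))// !normrM lerD//.
      by rewrite ler_piMr// ler_norml sin_geN1 sin_le1.
    by rewrite (gtr0_norm e0) ler_piMr ?(ltW e0)// ler_norml cos_geN1 cos_le1.
  + exact: cvg_cst.
  + rewrite -[X in _ --> X](mul0r K); apply: cvgMl.
    apply: (@cvg_comp _ _ _ (fun u => e * u) (fun v => expR (- v)) _ (pinfty_nbhs R)).
      exact: gt0_cvgMry.
    exact: cvgr_expR.
- by move=> u _; case: (dF u).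
- apply: cvg_at_right_filter.
  by apply: differentiable_continuous; apply/derivable1_diffP; case: (dF 0).
- by move=> u _; rewrite derive1E derive_val.
Qed.

Let expR_abs_1Dcos (e x : R) : 0 < e ->
  (\int[mu]_u (expR (- (e * `|u|)) * (1 + cos (x * u)))%:E =
   (2 * (e^-1 + e / (e ^+ 2 + x ^+ 2)))%:E)%E.
Proof.
move=> e0; rewrite ge0_symfun_integralT.
- rewrite -set_itvcy EFinM -integral_expR_1Dcos_ray//; congr (_ * _)%E.
  apply: eq_integral => u; rewrite inE/= in_itv/= andbT => u0.
  by rewrite ger0_norm.
- by move=> u; rewrite mulr_ge0 ?expR_ge0 ?oneDcos_ge0.
- move=> u; apply: cvgM.
    apply: continuous_comp; last exact: continuous_expR.
    apply: continuousN; apply: continuous_comp; first exact: norm_continuous.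
    exact: mulrl_continuous.
  apply: cvgD; first exact: cvg_cst.
  by apply: continuous_comp; [exact: mulrl_continuous|exact: continuous_cos].
- by move=> u /=; rewrite normrN mulrN cosN.
Qed.

Lemma measurable_expR_abs (e : R) : measurable_fun setT (fun u : R => expR (- (e * `|u|))).
Proof.
apply: measurableT_comp => //.
by apply: measurableT_comp => //; apply: measurable_funM.
Qed.

Lemma integral_expR_abs (e : R) : 0 < e ->
  (\int[mu]_u (expR (- (e * `|u|)))%:E = (2 / e)%:E)%E.
Proof.
move=> e0; have := expR_abs_1Dcos 0 e0.
under eq_integral do rewrite mul0r cos0 mulrC EFinM.
rewrite ge0_integralZl//; last by apply/measurable_EFinP; exact: measurable_expR_abs.
move=> /(congr1 (fun z => (1 + 1)^-1%:E * z)%E).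
rewrite muleA -!EFinM mulVf// mul1e => ->; congr EFin; rewrite expr0n/= addr0; field.
by rewrite gt_eqF.
Qed.

Lemma integrable_expR_abs (e : R) : 0 < e ->
  mu.-integrable setT (fun u => (expR (- (e * `|u|)))%:E).
Proof.
move=> e0; apply/integrableP; split.
  by apply/measurable_EFinP; exact: measurable_expR_abs.
under eq_integral do rewrite gee0_abs ?lee_fin ?expR_ge0//.
by rewrite integral_expR_abs// ltry.
Qed.

(** Both the integral with [1 + cos] and that of the weight are known and finite, so they can be
    subtracted. The value is twice the Poisson kernel. *)
Lemma integral_expR_abs_cos (e x : R) : 0 < e ->
  (\int[mu]_u (expR (- (e * `|u|)) * cos (x * u))%:E =
   (2 * (e / (e ^+ 2 + x ^+ 2)))%:E)%E.
Proof.
move=> e0.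
have mcos : measurable_fun setT (fun u : R => cos (x * u)).
  by apply: measurableT_comp => //; exact: continuous_measurable_fun (@continuous_cos R).
under eq_integral.
  move=> u _; rewrite (_ : _ * cos (x * u) = expR (- (e * `|u|)) * (1 + cos (x * u)) -
    expR (- (e * `|u|))); last by ring.
  rewrite EFinB; over.
rewrite integralB//=; last exact: integrable_expR_abs.
  rewrite expR_abs_1Dcos// integral_expR_abs// -EFinB; congr EFin; field.
  by rewrite !gt_eqF// ltr_pwDl ?exprn_gt0// sqr_ge0.
apply/integrableP; split.
  apply/measurable_EFinP/measurable_funM; first exact: measurable_expR_abs.
  exact: measurable_funD.
under eq_integral.
  move=> u _; rewrite gee0_abs; first over.
  by rewrite lee_fin mulr_ge0// ?expR_ge0// -lerBlDl sub0r cos_geN1.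
by rewrite expR_abs_1Dcos// ltry.
Qed.

End poisson_kernel.

Section product_sigma_finite.
Context d1 d2 (T1 : measurableType d1) (T2 : measurableType d2) (R : realType).
Variable m1 : {sigma_finite_measure set T1 -> \bar R}.
Variable m2 : {sigma_finite_measure set T2 -> \bar R}.

(** The exhausting sets are taken increasing, so that a point lying in [F n] and in [G k] lies in
    the rectangle of index [maxn n k]. *)
Lemma sigma_finite_product_measure1 : sigma_finite setT (m1 \x m2)%E.
Proof.
have /sigma_finiteP[F [TF ndF Foo]] := sigma_finiteT m1.
have /sigma_finiteP[G [TG ndG Goo]] := sigma_finiteT m2.
exists (fun n => F n `*` G n).
  apply/seteqP; split => // -[x y] _.
  have [n _ Fnx] : (\bigcup_i F i) x by rewrite -TF.
  have [k _ Gky] : (\bigcup_i G i) y by rewrite -TG.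
  exists (maxn n k) => //; split => /=.
    by move: x Fnx; exact/subsetPset/ndF/leq_maxl.
  by move: y Gky; exact/subsetPset/ndG/leq_maxr.
move=> k; have [mF Fk] := Foo k; have [mG Gk] := Goo k.
split; first exact: measurableX.
by rewrite product_measure1E// lte_mul_pinfty// ge0_fin_numE.
Qed.

(* The library registers a sigma-finite structure on [m1 \x m2] only for
   subprobabilities, whose instance shadows the general one. *)
Definition product_measure1_sigma_finite : {sigma_finite_measure set (T1 * T2)%type -> \bar R} :=
  HB.pack_for {sigma_finite_measure set (T1 * T2)%type -> \bar R} (m1 \x m2)%E
    (@Measure_isSigmaFinite.Build _ _ _ (m1 \x m2)%E sigma_finite_product_measure1).
End product_sigma_finite.

Section integrability_helpers.
Context {R : realType}.

Lemma EFin_Rintegral d (T : measurableType d) (m : {measure set T -> \bar R})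
    (D : set T) (h : T -> R) : measurable D ->
  m.-integrable D (EFin \o h) ->
  (\int[m]_(x in D) (h x)%:E = (Rintegral m D h)%:E)%E.
Proof. by move=> mD ih; rewrite fineK// integrable_fin_num. Qed.

Lemma integrable_scaler d (T : measurableType d) (m : {measure set T -> \bar R})
    (D : set T) (h : T -> R) (c : R) : measurable D ->
  m.-integrable D (EFin \o h) -> m.-integrable D (fun x => (h x * c)%:E).
Proof.
move=> mD ih; under eq_fun do rewrite EFinM.
exact: (integrableZr _ c ih).
Qed.

Lemma integrable_scalel d (T : measurableType d) (m : {measure set T -> \bar R})
    (D : set T) (h : T -> R) (c : R) : measurable D ->
  m.-integrable D (EFin \o h) -> m.-integrable D (fun x => (c * h x)%:E).
Proof.
move=> mD ih; under eq_fun do rewrite EFinM.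
exact: (integrableZl _ c ih).
Qed.

Lemma integrable_addr d (T : measurableType d) (m : {measure set T -> \bar R})
    (D : set T) (h1 h2 : T -> R) : measurable D ->
  m.-integrable D (EFin \o h1) -> m.-integrable D (EFin \o h2) ->
  m.-integrable D (fun x => (h1 x + h2 x)%:E).
Proof.
move=> mD i1 i2; under eq_fun do rewrite EFinD.
exact: (integrableD _ i1 i2).
Qed.

Lemma integrable_mul_bounded d (T : measurableType d)
    (m : {measure set T -> \bar R}) (D : set T) (a b : T -> R) :
  measurable D -> measurable_fun D b -> (forall x, D x -> `|b x| <= 1) ->
  m.-integrable D (EFin \o a) -> m.-integrable D (fun x => (a x * b x)%:E).
Proof.
move=> mD mb b1 ia; apply: (le_integrable _ _ _ ia) => //.
  apply/measurable_EFinP/measurable_funM => //.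
  by apply/measurable_EFinP; exact: measurable_int ia.
by move=> x Dx; rewrite /= lee_fin normrM ler_piMr// b1.
Qed.

Lemma integral_linear_combination d (T : measurableType d)
    (m : {measure set T -> \bar R}) (h1 h2 : T -> R) (a b : R) :
  m.-integrable setT (EFin \o h1) -> m.-integrable setT (EFin \o h2) ->
  (\int[m]_x (a * h1 x + b * h2 x)%:E =
   (a * Rintegral m setT h1 + b * Rintegral m setT h2)%:E)%E.
Proof.
move=> i1 i2.
have j1 := integrable_scalel a measurableT i1.
have j2 := integrable_scalel b measurableT i2.
rewrite (EFin_Rintegral measurableT (integrable_addr measurableT j1 j2)).
by rewrite (RintegralD measurableT j1 j2) !RintegralZl.
Qed.

Lemma integrable_tensor d1 d2 (T1 : measurableType d1) (T2 : measurableType d2)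
    (m1 : {sigma_finite_measure set T1 -> \bar R})
    (m2 : {sigma_finite_measure set T2 -> \bar R}) (a : T1 -> R) (b : T2 -> R) :
  m1.-integrable setT (EFin \o a) -> m2.-integrable setT (EFin \o b) ->
  (m1 \x m2)%E.-integrable setT (fun z => (a z.1 * b z.2)%:E).
Proof.
move=> ia ib.
have /measurable_EFinP ma := measurable_int _ ia.
have /measurable_EFinP mb := measurable_int _ ib.
apply/integrable12ltyP.
  apply/measurable_EFinP/measurable_funM.
    by apply: (measurableT_comp ma); exact: measurable_fst.
  by apply: (measurableT_comp mb); exact: measurable_snd.
have mna : measurable_fun setT (fun x => `|a x|%:E).
  by apply/measurable_EFinP/measurableT_comp.
have mnb : measurable_fun setT (fun x => `|b x|%:E).
  by apply/measurable_EFinP/measurableT_comp.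
under eq_integral => x _.
  under eq_integral do rewrite /= normrM EFinM.
  rewrite ge0_integralZl//.
  over.
rewrite ge0_integralZr//; last by apply: integral_ge0 => ? _.
move/integrableP : ia => [_ ia]; move/integrableP : ib => [_ ib].
apply: lte_mul_pinfty => //; first exact: integral_ge0.
by rewrite ge0_fin_numE//; exact: integral_ge0.
Qed.

End integrability_helpers.

Section plancherel.
Context {R : realType}.
Local Notation mu := (@lebesgue_measure R).

Lemma measurable_cosT : measurable_fun setT (@cos R).
Proof. exact: continuous_measurable_fun (@continuous_cos R). Qed.

Lemma measurable_sinT : measurable_fun setT (@sin R).
Proof. exact: continuous_measurable_fun (@continuous_sin R). Qed.

Lemma normr_cos_le1 (x : R) : `|cos x| <= 1.
Proof. by rewrite ler_norml cos_geN1 cos_le1. Qed.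

Lemma normr_sin_le1 (x : R) : `|sin x| <= 1.
Proof. by rewrite ler_norml sin_geN1 sin_le1. Qed.

(* Lebesgue measure lives on [measurableTypeR R], whose display is not that of
   the canonical measurable structure of [R]; hence the domains [mT * mT]. *)
Let mT := measurableTypeR R.

(** With [sin_transform], the real and imaginary parts of the Fourier integral of a real function
    [a]. *)
Definition cos_transform (a : R -> R) (u : R) : R :=
  Rintegral mu setT (fun t => a t * cos (t * u)).

Definition sin_transform (a : R -> R) (u : R) : R :=
  Rintegral mu setT (fun t => a t * sin (t * u)).

Context (a : R -> R) (ia : mu.-integrable setT (EFin \o a)).

Lemma integrable_mul_cos (u : R) :
  mu.-integrable setT (fun t => (a t * cos (t * u))%:E).
Proof.
apply: integrable_mul_bounded => //.
  by apply: (measurableT_comp measurable_cosT); exact: measurable_funM.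
by move=> t _; exact: normr_cos_le1.
Qed.

Lemma integrable_mul_sin (u : R) :
  mu.-integrable setT (fun t => (a t * sin (t * u))%:E).
Proof.
apply: integrable_mul_bounded => //.
  by apply: (measurableT_comp measurable_sinT); exact: measurable_funM.
by move=> t _; exact: normr_sin_le1.
Qed.

Let measurable_cosB (u : R) : measurable_fun setT
    (fun z : mT * mT => cos ((z.1 - z.2) * u)).
Proof.
apply: (measurableT_comp measurable_cosT); apply: measurable_funM => //.
by apply: measurable_funB; [exact: measurable_fst|exact: measurable_snd].
Qed.

(** The squared modulus of the Fourier integral as a quadratic form: [cos (t u) cos (s u) + sin (t
    u) sin (s u)] is [cos ((t - s) u)]. One factor of each square is kept as a constant while the
    other is expanded. *)
Let sqr_transform (u : R) :
  ((cos_transform a u ^+ 2 + sin_transform a u ^+ 2)%:E =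
   \int[(mu \x mu)%E]_z (a z.1 * a z.2 * cos ((z.1 - z.2) * u))%:E)%E.
Proof.
have iaa := integrable_tensor ia ia.
rewrite -integral12_prod_meas1; last first.
  exact: (integrable_mul_bounded measurableT (measurable_cosB u) (fun z _ => normr_cos_le1 _) iaa).
rewrite /fubini_F.
rewrite !expr2 -(integral_linear_combination _ _ (integrable_mul_cos u) (integrable_mul_sin u)).
apply: eq_integral => t _ /=.
rewrite (_ : cos_transform a u * _ + _ = a t * cos (t * u) * cos_transform a u +
  a t * sin (t * u) * sin_transform a u); last by ring.
rewrite -(integral_linear_combination _ _ (integrable_mul_cos u) (integrable_mul_sin u)).
by apply: eq_integral => s _; congr EFin; rewrite mulrBl cosB; ring.
Qed.

Let poisson (e x : R) : R := e / (e ^+ 2 + x ^+ 2).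

Let poisson_ge0 (e x : R) : 0 < e -> 0 <= poisson e x.
Proof. by move=> e0; rewrite divr_ge0 ?(ltW e0)// addr_ge0 ?sqr_ge0. Qed.

Let measurable_poissonB (e : R) : 0 < e ->
  measurable_fun setT (fun z : mT * mT => poisson e (z.1 - z.2)).
Proof.
move=> e0; apply: (@measurableT_comp _ _ _ _ _ _ (poisson e)); last first.
  by apply: measurable_funB; [exact: measurable_fst|exact: measurable_snd].
apply: continuous_measurable_fun => x; apply: cvgM; first exact: cvg_cst.
apply: cvgV; first by rewrite gt_eqF// ltr_pwDl ?exprn_gt0// sqr_ge0.
by apply: cvgD; [exact: cvg_cst|exact: exprn_continuous].
Qed.

Let ma : measurable_fun setT a.
Proof. by apply/measurable_EFinP; exact: measurable_int ia. Qed.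

(** The kernel is even in [z.1 - z.2], so it has mass [pi] in either variable; each of the two
    squares contributes [pi] times the integral of [a ^+ 2]. *)
Let integral_sqr_poisson (e : R) : 0 < e ->
  (\int[(mu \x mu)%E]_z ((a z.1 ^+ 2 + a z.2 ^+ 2) * poisson e (z.1 - z.2))%:E =
   (2 * pi)%:E * \int[mu]_t (a t ^+ 2)%:E)%E.
Proof.
move=> e0.
have mP := measurable_poissonB e0.
have ma2 : measurable_fun setT (fun t => (a t ^+ 2)%:E).
  by apply/measurable_EFinP; exact: measurable_funX.
have m1 : measurable_fun setT (fun z : mT * mT => (a z.1 ^+ 2 * poisson e (z.1 - z.2))%:E).
  apply/measurable_EFinP/measurable_funM => //; apply: measurable_funX.
  exact: (measurableT_comp ma (measurable_fst)).
have m2 : measurable_fun setT (fun z : mT * mT => (a z.2 ^+ 2 * poisson e (z.1 - z.2))%:E).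
  apply/measurable_EFinP/measurable_funM => //; apply: measurable_funX.
  exact: (measurableT_comp ma (measurable_snd)).
have p1 (z : mT * mT) : (0 <= (a z.1 ^+ 2 * poisson e (z.1 - z.2))%:E)%E.
  by rewrite lee_fin mulr_ge0 ?sqr_ge0 ?poisson_ge0.
have p2 (z : mT * mT) : (0 <= (a z.2 ^+ 2 * poisson e (z.1 - z.2))%:E)%E.
  by rewrite lee_fin mulr_ge0 ?sqr_ge0 ?poisson_ge0.
under eq_integral do rewrite mulrDl EFinD.
rewrite ge0_integralD//.
have mP1 t : measurable_fun setT (fun s : mT => (poisson e (t - s))%:E).
  by apply/measurable_EFinP; exact: (measurableT_comp mP (pair1_measurable t)).
have mP2 t : measurable_fun setT (fun s : mT => (poisson e (s - t))%:E).
  by apply/measurable_EFinP; exact: (measurableT_comp mP (pair2_measurable t)).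
have -> : (\int[(mu \x mu)]_z (a z.1 ^+ 2 * poisson e (z.1 - z.2))%:E =
    pi%:E * \int[mu]_t (a t ^+ 2)%:E)%E.
  rewrite fubini_tonelli1//= -ge0_integralZl//; last 2 first.
  - by move=> t _; rewrite lee_fin sqr_ge0.
  - by rewrite lee_fin pi_ge0.
  apply: eq_integral => t _; rewrite /fubini_F/=.
  under eq_integral do rewrite EFinM.
  rewrite ge0_integralZl//; last 2 first.
  - by move=> s _; rewrite lee_fin poisson_ge0.
  - by rewrite lee_fin sqr_ge0.
  by rewrite integral_poisson_kernel// muleC.
have -> : (\int[(mu \x mu)]_z (a z.2 ^+ 2 * poisson e (z.1 - z.2))%:E =
    pi%:E * \int[mu]_t (a t ^+ 2)%:E)%E.
  rewrite fubini_tonelli2//= -ge0_integralZl//; last 2 first.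
  - by move=> t _; rewrite lee_fin sqr_ge0.
  - by rewrite lee_fin pi_ge0.
  apply: eq_integral => t _; rewrite /fubini_G/=.
  under eq_integral do rewrite EFinM.
  rewrite ge0_integralZl//; last 2 first.
  - by move=> s _; rewrite lee_fin poisson_ge0.
  - by rewrite lee_fin sqr_ge0.
  under eq_integral do rewrite /poisson -(sqrrN (_ - _)) opprB.
  by rewrite integral_poisson_kernel// muleC.
rewrite -ge0_muleDl ?lee_fin ?pi_ge0// -EFinD; congr (_%:E * _)%E; ring.
Qed.

(* Fubini turns the left-hand side into the quadratic form of the Poisson kernel;
   2 a(t) a(s) <= a(t)^2 + a(s)^2 then separates the variables. *)
Let weighted_plancherel (e : R) : 0 < e ->
  (\int[mu]_u (expR (- (e * `|u|)) * (cos_transform a u ^+ 2 + sin_transform a u ^+ 2))%:E <=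
   (2 * pi)%:E * \int[mu]_t (a t ^+ 2)%:E)%E.
Proof.
move=> e0.
pose f (zu : (mT * mT) * mT) : \bar R :=
  (a zu.1.1 * a zu.1.2 * expR (- (e * `|zu.2|)) * cos ((zu.1.1 - zu.1.2) * zu.2))%:E.
have iaa := integrable_tensor ia ia.
pose mu2 := product_measure1_sigma_finite mu mu.
have iaaw := @integrable_tensor R _ _ _ _ mu2 mu (fun z => a z.1 * a z.2) _ iaa
  (integrable_expR_abs e0).
have intf : (mu2 \x mu)%E.-integrable setT f.
  apply: (integrable_mul_bounded measurableT _ _ iaaw); last first.
    by move=> z _; exact: normr_cos_le1.
  apply: (measurableT_comp measurable_cosT); apply: measurable_funM.
    apply: measurable_funB.
      by apply: measurableT_comp; [exact: measurable_fst|exact: measurable_fst].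
    by apply: measurableT_comp; [exact: measurable_snd|exact: measurable_fst].
  exact: measurable_snd.
have -> : (\int[mu]_u (expR (- (e * `|u|)) * (cos_transform a u ^+ 2 + sin_transform a u ^+ 2))%:E
    = \int[mu]_u \int[mu2]_z f (z, u))%E.
  apply: eq_integral => u _; rewrite EFinM sqr_transform -integralZl//.
    by apply: eq_integral => z _; rewrite -EFinM /f/=; congr EFin; ring.
  exact: (integrable_mul_bounded measurableT (measurable_cosB u) (fun z _ => normr_cos_le1 _) iaa).
rewrite -(Fubini intf) -(integral_sqr_poisson e0).
(* The inner integral has the sign of [a z.1 * a z.2]; passing to absolute values allows a
   comparison of nonnegative integrands. *)
rewrite (le_trans (lee_abs _))// (le_trans (le_abse_integral _ _ _))//.
  exact: (measurable_fubini_F intf).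
have fE z : (\int[mu]_u f (z, u) = (2 * (a z.1 * a z.2) * poisson e (z.1 - z.2))%:E)%E.
  rewrite /f/=; under eq_integral do rewrite -mulrA EFinM.
  rewrite integralZl//.
    by rewrite integral_expR_abs_cos// -EFinM; congr EFin; rewrite /poisson; ring.
  apply: (integrable_mul_bounded measurableT _ _ (integrable_expR_abs e0)).
    by apply: (measurableT_comp measurable_cosT); exact: measurable_funM.
  by move=> u _; exact: normr_cos_le1.
apply: ge0_le_integral => //.
- apply: measurableT_comp; last exact: (measurable_fubini_F intf).
  exact: abse_measurable.
- apply/measurable_EFinP/measurable_funM; last exact: measurable_poissonB.
  apply: measurable_funD; apply: measurable_funX.
    exact: (measurableT_comp ma measurable_fst).
  exact: (measurableT_comp ma measurable_snd).
move=> z _; rewrite fE/= lee_fin normrM (ger0_norm (poisson_ge0 _ _))// ler_wpM2r ?poisson_ge0//.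
rewrite -(real_normK (num_real (a z.1))) -(real_normK (num_real (a z.2))).
rewrite normrM normrM (@ger0_norm _ 2)// -subr_ge0.
by rewrite (_ : _ - _ = (`|a z.1| - `|a z.2|) ^+ 2) ?sqr_ge0//; ring.
Qed.

(* The weight [expR (- `|u|)] makes the integrand integrable in both variables. *)
Lemma measurable_transform (k p : R -> R) :
  measurable_fun setT k -> measurable_fun setT p ->
  (forall x, `|k x| <= 1) ->
  measurable_fun setT (fun u => Rintegral mu setT (fun t => a t * k (p t * u))).
Proof.
move=> mk mp k1.
have iaw := integrable_tensor ia (integrable_expR_abs (@ltr01 R)).
have intf : (mu \x mu)%E.-integrable setT
    (fun z : mT * mT => (a z.1 * expR (- (1 * `|z.2|)) * k (p z.1 * z.2))%:E).
  apply: (integrable_mul_bounded measurableT _ _ iaw).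
    apply: (measurableT_comp mk); apply: measurable_funM.
      exact: (measurableT_comp mp measurable_fst).
    exact: measurable_snd.
  by move=> z _; exact: k1.
have := measurable_fubini_G intf; rewrite /fubini_G => mf.
apply/measurable_EFinP.
(* The weight does not involve [t], so multiplying by its inverse outside the integral restores the
   unweighted transform. *)
rewrite (_ : EFin \o _ = (fun u : mT => (expR (1 * `|u|))%:E *
    \int[mu]_t (a t * expR (- (1 * `|u|)) * k (p t * u))%:E)%E).
  apply: emeasurable_funM => //; apply/measurable_EFinP.
  by apply: measurableT_comp => //; apply: measurable_funM.
apply/funext => u /=.
have iak : mu.-integrable setT (fun t => (a t * k (p t * u))%:E).
  apply: (integrable_mul_bounded measurableT _ _ ia) => //.
  by apply: (measurableT_comp mk); exact: measurable_funM.
under eq_integral do rewrite mulrAC mulrC EFinM.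
rewrite integralZl// EFin_Rintegral// -!EFinM mulrA -expRD subrr expR0 mul1r//.
Qed.

Lemma measurable_cos_transform : measurable_fun setT (cos_transform a).
Proof. exact: (measurable_transform measurable_cosT (@measurable_id _ _ _) normr_cos_le1). Qed.

Lemma measurable_sin_transform : measurable_fun setT (sin_transform a).
Proof. exact: (measurable_transform measurable_sinT (@measurable_id _ _ _) normr_sin_le1). Qed.

Lemma plancherel_le :
  (\int[mu]_u (cos_transform a u ^+ 2 + sin_transform a u ^+ 2)%:E <=
   (2 * pi)%:E * \int[mu]_t (a t ^+ 2)%:E)%E.
Proof.
pose Q u := cos_transform a u ^+ 2 + sin_transform a u ^+ 2.
have Q0 u : 0 <= Q u by rewrite addr_ge0 ?sqr_ge0.
have mQ : measurable_fun setT Q.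
  apply: measurable_funD; apply: measurable_funX.
    exact: measurable_cos_transform.
  exact: measurable_sin_transform.
(* [e = 1 / (n + 1)] is positive and decreases to 0, so the weights increase to 1: monotone
   convergence applies, with a bound uniform in [n]. *)
pose w (n : nat) (u : R) := (expR (- (n.+1%:R^-1 * `|u|)) * Q u)%:E.
have w_cvg u : w ^~ u @ \oo --> (Q u)%:E.
  apply: cvg_EFin; first by apply: nearW => n; rewrite /w.
  rewrite -[X in _ --> X]mul1r; apply: cvgMl.
  rewrite -[X in _ --> X](@expR0 R) -oppr0.
  apply: continuous_cvg; first exact: continuous_expR.
  apply: cvgN; rewrite -[X in _ --> X](mul0r `|u|); apply: cvgMl.
  exact: cvg_harmonic.
have cvg_w : (\int[mu]_u w n u)%E @[n --> \oo] --> (\int[mu]_u (Q u)%:E)%E.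
  rewrite (_ : (\int[mu]_u (Q u)%:E)%E = (\int[mu]_u limn (w ^~ u))%E); last first.
    by apply: eq_integral => u _; apply/esym/cvg_lim => //; exact: w_cvg.
  apply: cvg_monotone_convergence => //.
  - move=> n; apply/measurable_EFinP/measurable_funM => //.
    exact: measurable_expR_abs.
  - by move=> n u _; rewrite lee_fin mulr_ge0 ?expR_ge0.
  - move=> u _ m n mn; rewrite lee_fin ler_wpM2r// ler_expR lerN2 ler_wpM2r//.
    by rewrite lef_pV2 ?posrE// ler_nat.
rewrite -(cvg_lim _ cvg_w)//; apply: lime_le; first by apply/cvg_ex; eexists; exact: cvg_w.
by apply: nearW => n; apply: weighted_plancherel; rewrite invr_gt0.
Qed.

End plancherel.

(** * Square integrability of the ratio [Psi / M_c[g]] *)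

Section power_decay.
Context {R : realType}.
Local Notation mu := (@lebesgue_measure R).

Lemma oneDsqr_gt0 (t : R) : 0 < 1 + t ^+ 2.
Proof. by rewrite ltr_pwDl// sqr_ge0. Qed.

Lemma poly_decay_gt0 (a t : R) : 0 < poly_decay a t.
Proof. by rewrite powR_gt0// oneDsqr_gt0. Qed.

Lemma poly_decayD (a b t : R) :
  poly_decay (a + b) t = poly_decay a t * poly_decay b t.
Proof.
rewrite /poly_decay opprD mulrDl powRD//.
by apply/implyP => _; rewrite gt_eqF// oneDsqr_gt0.
Qed.

Lemma continuous_poly_decay (a : R) : continuous (poly_decay a).
Proof.
move=> t; rewrite (_ : poly_decay a = fun t => expR (- a / 2 * ln (1 + t ^+ 2))); last first.
  by apply/funext => x; rewrite /poly_decay /powR gt_eqF// oneDsqr_gt0.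
apply: continuous_comp; last exact: continuous_expR.
apply: continuousM; first exact: cvg_cst.
apply: continuous_comp; last by apply: continuous_ln; rewrite oneDsqr_gt0.
by apply: cvgD; [exact: cvg_cst|exact: exprn_continuous].
Qed.

Lemma integral_powR_ray (s : R) : 0 < s ->
  (\int[mu]_(t in `[0%R, +oo[) ((1 + t) `^ (- (s + 1)))%:E = (s^-1)%:E)%E.
Proof.
move=> s0.
pose F (t : R) := - (s^-1 * (1 + t) `^ (- s)).
have d1 (t : R) : is_derive t 1 (fun t : R => 1 + t) 1.
  by rewrite -[X in is_derive _ _ _ X]add0r; apply: is_deriveD.
have dG (a t : R) : 0 <= t ->
    is_derive t 1 (fun t : R => (1 + t) `^ a) (a * (1 + t) `^ (a - 1) * 1).
  move=> t0; have t1 : 0 < 1 + t by rewrite ltr_pwDl.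
  exact: (@is_derive1_comp _ (fun x : R => x `^ a) (fun t : R => 1 + t) t _ _
    (is_derive1_powR a t1) (d1 t)).
have dF (t : R) : 0 <= t -> is_derive t 1 F ((1 + t) `^ (- (s + 1))).
  move=> t0; have d3 := dG (- s) t t0.
  have -> : (1 + t) `^ (- (s + 1)) = - (s^-1 * (- s * (1 + t) `^ (- s - 1) * 1)).
    by rewrite opprD; field; rewrite gt_eqF.
  by apply: is_deriveN; apply: is_deriveZ.
rewrite (@ge0_continuous_FTC2y _ _ F _ 0).
- by rewrite -EFinB /F addr0 powR1 mulr1 sub0r opprK.
- by move=> t _; exact: powR_ge0.
- apply: continuous_in_subspaceT => t; rewrite inE/= in_itv/= andbT => t0.
  apply: differentiable_continuous; apply/derivable1_diffP.
  by case: (dG (- (s + 1)) t t0).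
- rewrite -[X in _ --> X]oppr0; apply: cvgN.
  rewrite -[X in _ --> X](mulr0 s^-1); apply: cvgMr.
  apply/cvgrPdist_le => e e0; near=> t.
  have t0 : 0 <= t by near: t; apply: nbhs_pinfty_ge; exact: num_real.
  have t1 : 0 < 1 + t by rewrite ltr_pwDl.
  rewrite sub0r normrN ger0_norm ?powR_ge0// powRN invf_ple ?posrE ?powR_gt0//.
  (* Writing [e^-1] as an [s]-th power reduces the claim to [e^-1 ^ (1/s) <= 1 + t], true for large
     [t]. *)
  have eE : e^-1 = (e^-1 `^ s^-1) `^ s.
    by rewrite -powRrM mulVf ?gt_eqF// powRr1// invr_ge0 ltW.
  rewrite eE; apply: ge0_ler_powR; rewrite ?(ltW s0) ?nnegrE ?powR_ge0 ?(ltW t1)//.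
  rewrite -lerBlDl; near: t; apply: nbhs_pinfty_ge; exact: num_real.
- by move=> t t0; case: (dF t (ltW t0)).
- apply: cvg_at_right_filter; apply: differentiable_continuous.
  by apply/derivable1_diffP; case: (dF 0 (lexx _)).
- move=> t; rewrite in_itv/= andbT => t0.
  by have := dF t (ltW t0) => ?; rewrite derive1E derive_val.
Unshelve. all: end_near. Qed.

(** From [(1 + t)^2 <= 2 (1 + t^2)], the integrand on the positive half-line is at most
    [2^(q/2) (1 + t)^(-q)]. *)
Lemma integral_poly_decay_lty (q : R) : 1 < q ->
  (\int[mu]_t (poly_decay q t)%:E < +oo)%E.
Proof.
move=> q1; rewrite ge0_symfun_integralT; last 3 first.
- by move=> t; rewrite ltW// poly_decay_gt0.
- exact: continuous_poly_decay.
- by move=> t /=; rewrite /poly_decay sqrrN.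
rewrite -set_itvcy.
suff : (\int[mu]_(x in `[0%R, +oo[) (poly_decay q x)%:E <=
        \int[mu]_(x in `[0%R, +oo[) ((2 `^ (q / 2))%:E * ((1 + x) `^ (- (q - 1 + 1)))%:E))%E.
  move=> le_q; rewrite lte_mul_pinfty// (le_lt_trans le_q)//.
  rewrite ge0_integralZl//=.
  - by rewrite integral_powR_ray ?subr_gt0// -EFinM ltry.
  - apply/measurable_EFinP/measurable_funTS.
    apply: (measurableT_comp (measurable_powR _)).
    exact: measurable_funD.
  - by move=> x _; rewrite lee_fin powR_ge0.
apply: ge0_le_integral => //=.
- by move=> t _; rewrite lee_fin ltW// poly_decay_gt0.
- apply/measurable_EFinP/measurable_funTS.
  exact: continuous_measurable_fun (@continuous_poly_decay q).
- apply/measurable_EFinP/measurable_funTS; apply: measurable_funM => //.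
  apply: (measurableT_comp (measurable_powR _)).
  exact: measurable_funD.
move=> t; rewrite in_itv/= andbT => t0; rewrite -EFinM lee_fin subrK.
have t1 : 0 < 1 + t by rewrite ltr_pwDl.
rewrite (_ : (1 + t) `^ (- q) = ((1 + t) ^+ 2) `^ (- (q / 2))); last first.
  by rewrite -powR_mulrn ?(ltW t1)// -powRrM; congr (_ `^ _); field.
rewrite /poly_decay (_ : - q / 2 = - (q / 2)); last by rewrite mulNr.
rewrite !powRN ler_pdivlMr ?powR_gt0 ?exprn_gt0//.
rewrite mulrC ler_pdivrMr ?powR_gt0 ?oneDsqr_gt0// -powRM ?(ltW (oneDsqr_gt0 _))//.
apply: ge0_ler_powR; rewrite ?nnegrE ?sqr_ge0 ?divr_ge0//.
- by rewrite (le_trans _ (ltW q1)).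
- by rewrite mulr_ge0// ltW// oneDsqr_gt0.
rewrite -subr_ge0 (_ : _ - _ = (1 - t) ^+ 2) ?sqr_ge0//; ring.
Qed.

(** This is [ln y < y] at [y = x d / A]: the slope [d] is arbitrarily small, at the cost of an
    additive constant. *)
Lemma ln_le_linear (A d x : R) : 0 < A -> 0 < d -> 0 < x ->
  A * ln x <= d * x + A * `|ln (A / d)|.
Proof.
move=> A0 d0 x0; have y0 : 0 < x * (d / A) by rewrite mulr_gt0// divr_gt0.
have := ln_sublinear y0; rewrite lnM ?posrE ?divr_gt0// -(opprK (ln (d / A))).
rewrite -lnV ?posrE ?divr_gt0// invf_div ltrBlDr => /ltW le_ln.
have -> : d * x = A * (x * (d / A)) by field; rewrite gt_eqF.
rewrite -mulrDr ler_wpM2l ?(ltW A0)// (le_trans le_ln)// lerD2l; exact: ler_norm.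
Qed.

(** In logarithms, [S * ln (1 + t^2)] has to stay below [d * |t|^r] plus a constant. For [|t| > 1]
    it is at most [S ln 2 + 2 S ln |t|], and [2 S ln |t| = A ln (|t|^r)]; for [|t| <= 1] it is at
    most [S ln 2]. *)
Lemma powR_mul_exp_bounded (s d r : R) : 0 < d -> 0 < r ->
  exists K, forall t : R, poly_decay s t * expR (- (d * `|t| `^ r)) <= K.
Proof.
(* The summand 1 keeps [S], hence [A], positive when [s = 0]. *)
move=> d0 r0; pose S := `|s / 2| + 1; pose A := S * 2 / r.
have S0 : 0 < S by rewrite ltr_wpDl.
have A0 : 0 < A by rewrite divr_gt0// mulr_gt0.
exists (expR (S * ln 2 + A * `|ln (A / d)|)) => t.
rewrite /poly_decay /powR gt_eqF ?oneDsqr_gt0// -expRD ler_expR.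
have lnt0 : 0 <= ln (1 + t ^+ 2) by rewrite ln_ge0// lerDl sqr_ge0.
have -> : (if `|t| == 0 then (r == 0)%:R else expR (r * ln `|t|)) = `|t| `^ r by [].
rewrite lerBlDr; apply: (@le_trans _ _ (S * ln (1 + t ^+ 2))).
  rewrite ler_wpM2r// mulNr (le_trans (ler_norm _))// normrN lerDl//.
have [t1|t1] := leP `|t| 1.
  have A1 : 0 <= A * `|ln (A / d)| by apply: mulr_ge0; rewrite // ltW.
  have d1 : 0 <= d * `|t| `^ r by apply: mulr_ge0; rewrite ?powR_ge0// ltW.
  rewrite -addrA ler_wpDr ?addr_ge0// ler_wpM2l ?(ltW S0)// ler_ln ?posrE ?oneDsqr_gt0//.
  by rewrite -[leRHS]/(1 + 1) lerD2l -(real_normK (num_real t)) expr_le1.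
have t0 : 0 < `|t| by rewrite (lt_trans ltr01).
rewrite -addrA; apply: (@le_trans _ _ (S * (ln 2 + 2 * ln `|t|))).
  rewrite ler_wpM2l ?(ltW S0)// mulr_natl -lnXn// -lnM ?posrE ?exprn_gt0//.
  rewrite ler_ln ?posrE ?oneDsqr_gt0 ?mulr_gt0 ?exprn_gt0//.
  by rewrite real_normK ?num_real// mulr2n mulrDl !mul1r lerD2r -(real_normK (num_real t)) expr_ge1// ltW.
rewrite mulrDr lerD2l addrC (_ : S * (2 * ln `|t|) = A * ln (`|t| `^ r)).
  by apply: ln_le_linear; rewrite ?powR_gt0.
by rewrite ln_powR /A; field; rewrite gt_eqF.
Qed.

(** Where [l x^rho] exceeds [m x^r], dividing by [x^rho] gives [x <= T], so there
    [l x^rho <= l T^rho]. *)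
Lemma powR_dominated (m l r rho : R) : 0 < m -> 0 <= l -> 0 < rho -> rho < r ->
  exists K, forall x : R, 0 <= x -> l * x `^ rho <= m * x `^ r + K.
Proof.
move=> m0 l0 rho0 rhor; pose T := (l / m) `^ (r - rho)^-1.
have rr0 : 0 < r - rho by rewrite subr_gt0.
exists (l * T `^ rho) => x x0.
have [le_lm|] := leP (l * x `^ rho) (m * x `^ r).
  by rewrite ler_wpDr// mulr_ge0// powR_ge0.
move=> lt_ml; rewrite ler_wpDl ?mulr_ge0 ?powR_ge0 ?(ltW m0)// ler_wpM2l//.
move: x0; rewrite le_eqVlt => /predU1P[x0|x0].
  by rewrite -x0 powR0 ?gt_eqF// powR_ge0.
apply: ge0_ler_powR; rewrite ?nnegrE ?powR_ge0 ?(ltW x0) ?(ltW rho0)//.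
have xE : x = (x `^ (r - rho)) `^ (r - rho)^-1.
  by rewrite -powRrM mulfV ?gt_eqF// powRr1// ltW.
rewrite xE; apply: ge0_ler_powR; rewrite ?nnegrE ?powR_ge0 ?invr_ge0 ?(ltW rr0) ?divr_ge0 ?(ltW m0)//.
rewrite powRB; last by apply/implyP => _; rewrite gt_eqF.
rewrite ler_pdivrMr ?powR_gt0// mulrAC ler_pdivlMr// mulrC; exact: ltW.
Qed.

End power_decay.

Section ratio_decay.
Context {R : realType}.
Implicit Types (M Psi : R -> R[i]).

Lemma normc_ge0 (z : R[i]) : 0 <= Normc.normc z.
Proof. by case: z => a b; exact: sqrtr_ge0. Qed.

Lemma poly_decayB (a b t : R) :
  poly_decay (a - b) t = poly_decay a t / poly_decay b t.
Proof.
by rewrite -[in RHS](subrK b a) [in RHS]poly_decayD mulfK// gt_eqF// poly_decay_gt0.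
Qed.

Lemma sqr_poly_decay_ratio (p gamma t : R) :
  (poly_decay p t / poly_decay gamma t) ^+ 2 = poly_decay (2 * p - 2 * gamma) t.
Proof. by rewrite -mulrBr mulr2n mulrDl mul1r -poly_decayB expr2 -poly_decayD. Qed.

Lemma two_sided_bound_ratio Psi M (e1 e2 : R -> R) :
  (forall t, 0 <= e1 t) -> (forall t, 0 < e2 t) ->
  two_sided_bound Psi e1 -> two_sided_bound M e2 ->
  exists2 K, 0 <= K &
    forall t, Normc.normc (Psi t / M t) ^+ 2 <= K * (e1 t / e2 t) ^+ 2.
Proof.
move=> e10 e20 [c1 [C1 [_ C10 Psi_le]]] [c2 [C2 [c20 _ M_ge]]].
exists ((C1 / c2) ^+ 2); first exact: sqr_ge0.
move=> t; rewrite -exprMn lerXn2r ?nnegrE ?normc_ge0//.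
  by rewrite mulr_ge0// divr_ge0// ltW.
rewrite Normc.normcM Normc.normcV.
have [_ Psi_t] := andP (Psi_le t); have [M_t _] := andP (M_ge t).
have cM : 0 < c2 * e2 t by rewrite mulr_gt0.
rewrite mulf_div ler_pM ?normc_ge0 ?invr_ge0 ?normc_ge0//.
by rewrite lef_pV2 ?posrE// (lt_le_trans cM).
Qed.

Lemma ratio_bound_poly Psi M (e1 e2 : R -> R) (K q : R) :
  (forall t, 0 <= e1 t) -> (forall t, 0 < e2 t) ->
  two_sided_bound Psi e1 -> two_sided_bound M e2 -> 1 < q ->
  (forall t, (e1 t / e2 t) ^+ 2 <= K * poly_decay q t) ->
  exists K q, 1 < q /\
    forall t, Normc.normc (Psi t / M t) ^+ 2 <= K * poly_decay q t.
Proof.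
move=> e10 e20 bPsi bM q1 le_e.
have [K' K'0 leK'] := two_sided_bound_ratio e10 e20 bPsi bM.
exists (K' * K), q; split=> // t; rewrite (le_trans (leK' t))//.
by rewrite -mulrA ler_wpM2l.
Qed.

Lemma exp_decay_gt0 (a l r t : R) : 0 < exp_decay a l r t.
Proof. by rewrite mulr_gt0 ?expR_gt0 ?poly_decay_gt0. Qed.

(** Lets a smooth error density be treated as one with exponential rate 0. *)
Lemma exp_decay0 (a r : R) : exp_decay a 0 r = poly_decay a.
Proof. by apply/funext => t; rewrite /exp_decay oppr0 mul0r expR0 mulr1. Qed.

(** [d] is a margin in the exponential rate: up to a constant the squared ratio carries the factor
    [e^(-2 d |t|^r)], which absorbs any polynomial growth. It can thus pay for the exponent
    [2 p - 2 gamma - 2] and leave [poly_decay 2], where 2 is a convenient exponent above 1. *)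
Lemma exp_decay_ratio_bound (p m r gamma l rho d K : R) : 0 < d -> 0 < r ->
  (forall x, 0 <= x -> l * x `^ rho <= (m - d) * x `^ r + K) ->
  exists K', forall t, (exp_decay p m r t / exp_decay gamma l rho t) ^+ 2 <=
    K' * poly_decay 2 t.
Proof.
move=> d0 r0 le_l.
have [K1 leK1] := powR_mul_exp_bounded (2 * p - 2 * gamma - 2) (mulr_gt0 (@ltr0Sn R 1) d0) r0.
exists (K1 * expR (2 * K)) => t.
have -> : (exp_decay p m r t / exp_decay gamma l rho t) ^+ 2 =
    poly_decay (2 * p - 2 * gamma - 2) t * poly_decay 2 t *
    expR (2 * (- m * `|t| `^ r + l * `|t| `^ rho)).
  rewrite -poly_decayD subrK -sqr_poly_decay_ratio /exp_decay -mulf_div exprMn.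
  congr (_ * _); rewrite mulr2n mulrDl mul1r expRD -expr2; congr (_ ^+ 2).
  by rewrite expRD; congr (_ * _); rewrite -expRN mulNr opprK.
rewrite mulrAC ler_wpM2r// ?(ltW (poly_decay_gt0 _ _))//.
apply: (@le_trans _ _ (poly_decay (2 * p - 2 * gamma - 2) t *
    (expR (- (2 * d * `|t| `^ r)) * expR (2 * K)))).
  rewrite ler_wpM2l ?(ltW (poly_decay_gt0 _ _))// -expRD ler_expR.
  have := le_l _ (normr_ge0 t); move: (_ `^ rho) (_ `^ r) => u v; nra.
by rewrite mulrA ler_wpM2r ?expR_ge0.
Qed.

Lemma ratio_decay (Psi M : R -> R[i]) :
  (exists p gamma : R, [/\ 0 <= p /\ two_sided_bound Psi (poly_decay p),
      0 < gamma /\ two_sided_bound M (poly_decay gamma) &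
      1 < 2 * p - 2 * gamma]) \/
  ((exists p m r : R, [/\ 0 < m, 0 < r & two_sided_bound Psi (exp_decay p m r)]) /\
    (exists gamma : R, 0 < gamma /\ two_sided_bound M (poly_decay gamma))) \/
  (exists p m r gamma lambda rho : R,
      [/\ [/\ 0 < m, 0 < r & two_sided_bound Psi (exp_decay p m r)],
        [/\ 0 < lambda, 0 < rho & two_sided_bound M (exp_decay gamma lambda rho)] &
        rho < r \/ (r = rho /\ lambda < m) \/
        [/\ r = rho, m = lambda & 1 < 2 * p - 2 * gamma]]) ->
  exists K q, 1 < q /\
    forall t, Normc.normc (Psi t / M t) ^+ 2 <= K * poly_decay q t.
Proof.
have poly0 a t : 0 <= poly_decay a t := ltW (poly_decay_gt0 a t).
have exp0 (a l r t : R) : 0 <= exp_decay a l r t := ltW (exp_decay_gt0 a l r t).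
move=> [|[|]].
- move=> [p [gamma [[_ bPsi] [_ bM] pg]]].
  apply: (@ratio_bound_poly _ _ _ _ 1 _ _ _ bPsi bM pg) => // [t|t]; first exact: poly_decay_gt0.
  by rewrite sqr_poly_decay_ratio mul1r.
(* Here [M] has rate 0, so the whole rate [m] of [Psi] serves as margin. *)
- move=> [[p [m [r [m0 r0 bPsi]]]] [gamma [_ bM]]].
  rewrite -(exp_decay0 _ 0) in bM.
  have [|K leK] := @exp_decay_ratio_bound p m r gamma 0 0 m 0 m0 r0.
    by move=> x _; rewrite mul0r subrr mul0r addr0.
  by apply: (ratio_bound_poly _ _ bPsi bM _ leK) => // [t|]; [exact: exp_decay_gt0|rewrite ltr1n].
move=> [p [m [r [gamma [l [rho [[m0 r0 bPsi] [l0 rho0 bM] cases]]]]]]].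
case: cases => [rhor|[[rrho lm]|[rrho ml pg]]].
(* Half of the rate of [Psi] dominates the exponential of [M]; the other half is the margin. *)
- have [K leK] := powR_dominated (divr_gt0 m0 (@ltr0Sn R 1)) (ltW l0) rho0 rhor.
  have [|K' leK'] := @exp_decay_ratio_bound p m r gamma l rho (m / 2) K (divr_gt0 m0 (@ltr0Sn R 1)) r0.
    move=> x x0; rewrite (le_trans (leK x x0))// (_ : m - m / 2 = m / 2)//; by field.
  by apply: (ratio_bound_poly _ _ bPsi bM _ leK') => // [t|]; [exact: exp_decay_gt0|rewrite ltr1n].
- have [||K leK] := @exp_decay_ratio_bound p m r gamma l rho (m - l) 0 _ r0.
  + by rewrite subr_gt0.
  + by move=> x _; rewrite rrho addr0 opprB addrCA subrr addr0.
  by apply: (ratio_bound_poly _ _ bPsi bM _ leK) => // [t|]; [exact: exp_decay_gt0|rewrite ltr1n].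
(* The exponentials are equal and cancel, which leaves the polynomial ratio. *)
- apply: (@ratio_bound_poly _ _ _ _ 1 _ _ _ bPsi bM pg) => // [t|t]; first exact: exp_decay_gt0.
  by rewrite mul1r -sqr_poly_decay_ratio rrho ml /exp_decay -mulf_div divff ?mulr1// gt_eqF// expR_gt0.
Qed.

End ratio_decay.

(** * Independent observations *)

Section independence.
Context {R : realType} d (Omega : measurableType d) (P : probability Omega R).
Context (n : nat) (Y : 'I_n -> {RV P >-> R}).
Hypothesis indep : mutually_independent Y.

(** The product rule for the full family is applied with [setT] at all other indices, whose factors
    are 1. *)
Lemma independent_pair (i j : 'I_n) (A B : set R) : i != j ->
  measurable A -> measurable B ->
  P (Y i @^-1` A `&` Y j @^-1` B) = (P (Y i @^-1` A) * P (Y j @^-1` B))%E.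
Proof.
move=> ij mA mB.
pose C k := if k == i then A else if k == j then B else setT.
have Ci : C i = A by rewrite /C eqxx.
have Cj : C j = B by rewrite /C eq_sym (negbTE ij) eqxx.
have mC k : measurable (C k) by rewrite /C; case: ifP => // _; case: ifP.
have := indep mC.
rewrite (bigD1 i)//= (bigD1 j)//= ?[j == i]eq_sym// big1; last first.
  move=> k /andP[ki kj]; rewrite /C (negbTE ki) (negbTE kj) preimage_setT.
  exact: probability_setT.
rewrite mule1 Ci Cj => <-; congr (P _); apply/seteqP; split => w /=.
  move=> [Aw Bw] k _; rewrite /C; case: ifPn => [/eqP ->//|_].
  by case: ifPn => // /eqP ->.
by move=> Cw; split; [have := Cw i I; rewrite Ci|have := Cw j I; rewrite Cj].
Qed.

(** By uniqueness of product measures, the law of [(Y i, Y j)] is the product of the two marginal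
    laws; Fubini then factors the integral. *)
Lemma integral_independent_mul (h : R -> R) (i j : 'I_n) (a b : R) : i != j ->
  measurable_fun setT h ->
  P.-integrable setT (fun w => (h (Y i w))%:E) ->
  P.-integrable setT (fun w => (h (Y j w))%:E) ->
  (\int[P]_w (h (Y i w))%:E = a%:E)%E -> (\int[P]_w (h (Y j w))%:E = b%:E)%E ->
  P.-integrable setT (fun w => (h (Y i w) * h (Y j w))%:E) /\
  (\int[P]_w (h (Y i w) * h (Y j w))%:E = (a * b)%:E)%E.
Proof.
move=> ij mh ii ij' Ea Eb.
pose pY (w : Omega) : R * R := (Y i w, Y j w).
have mpY : measurable_fun setT pY by exact/measurable_fun_pair.
pose m' := pushforward_measure P mpY.
have m'E X : measurable X -> (distribution P (Y i) \x distribution P (Y j))%E X = m' X.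
  move=> mX; apply: product_measure_unique => // A B mA mB.
  exact: independent_pair.
have mhE : measurable_fun setT (EFin \o h) by exact/measurable_EFinP.
have int_h k : P.-integrable setT (fun w => (h (Y k w))%:E) ->
    (distribution P (Y k)).-integrable setT (EFin \o h).
  by move=> ih; apply: integrable_pushforward.
have ihh := integrable_tensor (int_h _ ii) (int_h _ ij').
have mhh : measurable_fun setT (fun z : R * R => (h z.1 * h z.2)%:E).
  exact: measurable_int ihh.
have iP : P.-integrable setT (fun w => (h (Y i w) * h (Y j w))%:E).
  apply/integrableP; split; first exact: (measurableT_comp mhh mpY).
  rewrite -(@ge0_integral_pushforward _ _ _ _ _ pY mpY P setT
    (fun z => `|(h z.1 * h z.2)%:E|%E))//; last exact: measurableT_comp.
  rewrite (eq_measure_integral (distribution P (Y i) \x distribution P (Y j))%E).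
    by case/integrableP : ihh.
  by move=> X mX _; apply/esym; exact: m'E.
split => //.
rewrite -(@integral_pushforward _ _ _ _ _ pY mpY P setT (fun z => (h z.1 * h z.2)%:E))//.
rewrite (eq_measure_integral (distribution P (Y i) \x distribution P (Y j))%E); last first.
  by move=> X mX _; apply/esym; exact: m'E.
rewrite -integral12_prod_meas1//= /fubini_F/=.
under eq_integral => x _.
  under eq_integral do rewrite EFinM.
  rewrite integralZl//; last exact: int_h.
  rewrite integral_distribution//= Eb; over.
rewrite integralZr//; last exact: int_h.
by rewrite integral_distribution//= Ea.
Qed.

End independence.

(** * Mean square error of an average of independent copies *)

Section mean_square_error.
Context {R : realType} d (Omega : measurableType d) (P : probability Omega R).
Context (n : nat) (Y : 'I_n -> {RV P >-> R}).
Hypothesis indep : mutually_independent Y.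

Lemma integrable_of_sqr (X : Omega -> R) : measurable_fun setT X ->
  (\int[P]_w (X w ^+ 2)%:E < +oo)%E -> P.-integrable setT (EFin \o X).
Proof.
move=> mX X2; apply: (@le_integrable _ _ _ P _ _ _ (fun w => (1 + X w ^+ 2)%:E)) => //.
- exact/measurable_EFinP.
- move=> w _; rewrite /= lee_fin [leRHS]ger0_norm ?addr_ge0 ?sqr_ge0//.
  rewrite -(real_normK (num_real (X w))) -subr_ge0.
  have := sqr_ge0 (`|X w| - 1); have := sqr_ge0 `|X w|; move: `|X w| => x; nra.
- apply: integrable_addr => //.
    exact: finite_measure_integrable_cst.
  apply/integrableP; split; first exact/measurable_EFinP/measurable_funX.
  by under eq_integral do rewrite gee0_abs ?lee_fin ?sqr_ge0//.
Qed.

(** The summands are centred at the target [a] rather than at their mean. By independence an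
    off-diagonal product has mean [(m - a)^2]; a diagonal one has mean at most
    [v - 2 a m + a^2 <= v + (m - a)^2]. Summing [n^2] terms and dividing by [n^2] leaves [v / n]
    plus the squared bias. *)
Lemma mean_square_error_le (h : R -> R) (v m a : R) : (0 < n)%N ->
  measurable_fun setT h ->
  (forall i, \int[P]_w (h (Y i w) ^+ 2)%:E <= v%:E)%E ->
  (forall i, \int[P]_w (h (Y i w))%:E = m%:E)%E ->
  (\int[P]_w ((n%:R^-1 * (\sum_(i < n) h (Y i w)) - a) ^+ 2)%:E <=
   (v / n%:R + (m - a) ^+ 2)%:E)%E.
Proof.
move=> n0 mh le_v Em.
have mhY i : measurable_fun setT (fun w => h (Y i w)) by exact: (measurableT_comp mh).
have ih i : P.-integrable setT (fun w => (h (Y i w))%:E).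
  by apply: integrable_of_sqr => //; apply: le_lt_trans (le_v i) _; exact: ltry.
have icst (k : R) : P.-integrable setT (fun=> k%:E).
  exact: (finite_measure_integrable_cst P k).
pose g y := h y - a.
have mg : measurable_fun setT g by exact: measurable_funB.
have ig i : P.-integrable setT (fun w => (g (Y i w))%:E).
  apply: (@integrable_addr _ _ _ _ _ (fun w => h (Y i w)) (fun=> - a)) => //.
    exact: ih.
  exact: icst.
have Eg i : (\int[P]_w (g (Y i w))%:E = (m - a)%:E)%E.
  under eq_integral do rewrite /g EFinB.
  rewrite (integralB measurableT (ih i) (icst a)).
  by rewrite Em integral_cst//= probability_setT mule1.
have ih2 i : P.-integrable setT (fun w => (h (Y i w) ^+ 2)%:E).
  apply/integrableP; split; first exact/measurable_EFinP/measurable_funX.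
  under eq_integral do rewrite gee0_abs ?lee_fin ?sqr_ge0//.
  by apply: le_lt_trans (le_v i) _; exact: ltry.
have Eg2 i : P.-integrable setT (fun w => (g (Y i w) * g (Y i w))%:E) /\
    (\int[P]_w (g (Y i w) * g (Y i w))%:E <= (v + (m - a) ^+ 2)%:E)%E.
  have gE w : g (Y i w) * g (Y i w) = h (Y i w) ^+ 2 + (h (Y i w) * (- (2 * a)) + a ^+ 2).
    by rewrite /g; ring.
  have i1 : P.-integrable setT (fun w => (h (Y i w) * (- (2 * a)))%:E).
    exact: (integrable_scaler _ measurableT (ih i)).
  have i0 : P.-integrable setT (fun w : Omega => (a ^+ 2)%:E).
    exact: icst.
  have i2 : P.-integrable setT (fun w => (h (Y i w) * (- (2 * a)) + a ^+ 2)%:E).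
    exact: (integrable_addr measurableT i1 i0).
  split.
    under eq_fun do rewrite gE.
    exact: (integrable_addr measurableT (ih2 i) i2).
  under eq_integral do rewrite gE EFinD.
  rewrite (integralD measurableT (ih2 i) i2).
  under [X in (_ + X <= _)%E]eq_integral do rewrite EFinD.
  rewrite (integralD measurableT i1 i0).
  under [X in (_ + (X + _) <= _)%E]eq_integral do rewrite EFinM.
  rewrite (integralZr measurableT (ih i)) Em integral_cst//= probability_setT mule1 -EFinM -EFinD.
  apply: (@le_trans _ _ (v%:E + (m * - (2 * a) + a ^+ 2)%:E)%E); first exact: leeD2r.
  by rewrite -EFinD lee_fin; have := sqr_ge0 m; nra.
have Egg i j : P.-integrable setT (fun w => (g (Y i w) * g (Y j w))%:E) /\
    (\int[P]_w (g (Y i w) * g (Y j w))%:E <= ((i == j)%:R * v + (m - a) ^+ 2)%:E)%E.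
  have [<-|ij] := eqVneq i j; first by rewrite mul1r; exact: Eg2.
  have [? ->] := integral_independent_mul indep ij mg (ig i) (ig j) (Eg i) (Eg j).
  by rewrite mul0r add0r expr2.
have nn0 : n%:R != 0 :> R by rewrite pnatr_eq0 -lt0n.
have sqE w : (n%:R^-1 * (\sum_(i < n) h (Y i w)) - a) ^+ 2 =
    n%:R^-1 ^+ 2 * (\sum_(i < n) \sum_(j < n) g (Y i w) * g (Y j w)).
  rewrite -big_distrlr /= -expr2 -exprMn; congr (_ ^+ 2).
  rewrite sumrB sumr_const card_ord mulrBr; congr (_ - _).
  by rewrite -[a *+ n]mulr_natl mulKf.
under eq_integral do rewrite sqE EFinM -sumEFin.
under eq_integral => w _.
  under eq_bigr do rewrite -sumEFin. over.
have iS i : P.-integrable setT (fun w => \sum_(j < n) (g (Y i w) * g (Y j w))%:E)%E.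
  by apply: integrable_sum => // j _; case: (Egg i j).
rewrite integralZl//; last by apply: integrable_sum.
rewrite integral_sum//.
apply: (@le_trans _ _ ((n%:R^-1 ^+ 2)%:E *
    \sum_(i < n) \sum_(j < n) ((i == j)%:R * v + (m - a) ^+ 2)%:E)%E).
  rewrite lee_wpmul2l// ?lee_fin ?sqr_ge0//; apply: lee_sum => i _.
  rewrite integral_sum//; last by move=> j; case: (Egg i j).
  by apply: lee_sum => j _; case: (Egg i j).
under eq_bigr do rewrite sumEFin; rewrite sumEFin -EFinM lee_fin.
rewrite le_eqVlt; apply/orP; left; apply/eqP.
under eq_bigr => i _.
  rewrite big_split/= sumr_const card_ord (bigD1 i)//= eqxx mul1r big1 ?addr0; last first.
    by move=> j ji; rewrite eq_sym (negbTE ji) mul0r.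
  over.
rewrite sumr_const card_ord -[(_ + _) *+ n]mulr_natr -[(_ ^+ 2) *+ n]mulr_natr.
by field.
Qed.

End mean_square_error.

(** * The law of a product and its Mellin transform *)

Section mellin_density.
Context {R : realType}.
Local Notation mu := (@lebesgue_measure R).
Let mT := measurableTypeR R.

(** Extension by 0 off the positive half-line, so that Fubini can be used on the whole plane;
    [weighted 0 q] is [q] itself so extended. *)
Definition weighted (a : R) (q : R -> R) : R -> R :=
  (fun x => x `^ a * q x) \_ (@Rpos R).

Lemma in_Rpos (x : R) : (x \in @Rpos R) = (0 < x).
Proof. by rewrite /Rpos mem_setE in_itv/= andbT. Qed.

Lemma weighted_pos a q x : 0 < x -> weighted a q x = x `^ a * q x.
Proof. by move=> x0; rewrite /weighted patchE in_Rpos x0. Qed.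

Lemma weighted_npos a q x : x <= 0 -> weighted a q x = 0.
Proof.
by move=> x0; rewrite /weighted patchE in_Rpos ltNge x0.
Qed.

Lemma weighted_ge0 a q x : (forall x, 0 < x -> 0 <= q x) -> 0 <= weighted a q x.
Proof.
move=> q0; have [x0|x0] := leP x 0; first by rewrite weighted_npos.
by rewrite weighted_pos// mulr_ge0 ?powR_ge0// q0.
Qed.

Lemma measurable_weighted a q : measurable_fun (@Rpos R) q ->
  measurable_fun setT (weighted a q).
Proof.
move=> mq; apply/(measurable_restrictT _ _).1 => //.
  exact: measurable_Rpos.
apply: measurable_funM => //; apply: measurable_funTS; exact: (measurable_powR a).
Qed.

Lemma integral_weighted a q :
  (\int[mu]_x (weighted a q x)%:E = \int[mu]_(x in Rpos) (x `^ a * q x)%:E)%E.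
Proof.
rewrite [RHS]integral_mkcond; apply: eq_integral => x _.
by rewrite /weighted !patchE; case: ifP.
Qed.

Lemma integrable_weighted a q : density q -> wLp 1 a (cfun q) ->
  mu.-integrable setT (EFin \o weighted a q).
Proof.
move=> [mq q0 _] [_ Lq]; apply/integrableP; split.
  by apply/measurable_EFinP; exact: measurable_weighted.
under eq_integral do rewrite /= ger0_norm ?weighted_ge0//.
rewrite integral_weighted; apply: le_lt_trans Lq.
rewrite le_eqVlt; apply/orP; left; apply/eqP.
apply: eq_integral => x; rewrite in_Rpos => x0.
by rewrite /cfun/= expr0n/= addr0 sqrtr_sqr ger0_norm ?q0// powRr1 ?q0// mulrC.
Qed.

Lemma Re_mellin (c : R) (q : R -> R) t : complex.Re (mellin c (cfun q) t) =
  Rintegral mu setT (fun x => weighted (c - 1) q x * cos (ln x * t)).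
Proof.
rewrite /mellin /cintegral/= Rintegral_mkcond; apply: eq_Rintegral => x _.
rewrite /weighted !patchE; case: ifP => _; last by rewrite mul0r.
by rewrite /= mulr0 subr0 [t * _]mulrC; ring.
Qed.

Lemma Im_mellin (c : R) (q : R -> R) t : complex.Im (mellin c (cfun q) t) =
  Rintegral mu setT (fun x => weighted (c - 1) q x * sin (ln x * t)).
Proof.
rewrite /mellin /cintegral/= Rintegral_mkcond; apply: eq_Rintegral => x _.
rewrite /weighted !patchE; case: ifP => _; last by rewrite mul0r.
by rewrite /= mulr0 add0r [t * _]mulrC; ring.
Qed.

Lemma measurable_Re_mellin (c : R) (q : R -> R) : density q -> wLp 1 (c - 1) (cfun q) ->
  measurable_fun setT (fun t : R => complex.Re (mellin c (cfun q) t)).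
Proof.
move=> dq Lq; under eq_fun do rewrite Re_mellin.
exact: (measurable_transform (integrable_weighted dq Lq) (@measurable_cosT R)
  (@measurable_ln R) (@normr_cos_le1 R)).
Qed.

Lemma measurable_Im_mellin (c : R) (q : R -> R) : density q -> wLp 1 (c - 1) (cfun q) ->
  measurable_fun setT (fun t : R => complex.Im (mellin c (cfun q) t)).
Proof.
move=> dq Lq; under eq_fun do rewrite Im_mellin.
exact: (measurable_transform (integrable_weighted dq Lq) (@measurable_sinT R)
  (@measurable_ln R) (@normr_sin_le1 R)).
Qed.

(** The real form of [(Cf + i Sf) (Cg + i Sg)]: the addition formulas for the angle
    [(ln x + ln z) t], integrated one variable at a time. At [a = c - 1] the right-hand sides are
    the parts of [M_c[f] M_c[g]]. *)
Lemma integral_weighted_angle (a : R) (f g : R -> R) (t : R) :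
  mu.-integrable setT (EFin \o weighted a f) ->
  mu.-integrable setT (EFin \o weighted a g) ->
  let Cf := Rintegral mu setT (fun x => weighted a f x * cos (ln x * t)) in
  let Sf := Rintegral mu setT (fun x => weighted a f x * sin (ln x * t)) in
  let Cg := Rintegral mu setT (fun x => weighted a g x * cos (ln x * t)) in
  let Sg := Rintegral mu setT (fun x => weighted a g x * sin (ln x * t)) in
  (\int[(mu \x mu)%E]_z (weighted a f z.1 * weighted a g z.2 *
      cos ((ln z.1 + ln z.2) * t))%:E = (Cf * Cg - Sf * Sg)%:E)%E /\
  (\int[(mu \x mu)%E]_z (weighted a f z.1 * weighted a g z.2 *
      sin ((ln z.1 + ln z.2) * t))%:E = (Sf * Cg + Cf * Sg)%:E)%E.
Proof.
move=> if_ ig Cf Sf Cg Sg.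
have mlnt : measurable_fun setT (fun x : mT => ln x * t).
  by apply: measurable_funM => //; exact: (@measurable_ln R).
have mc : measurable_fun setT (fun x : mT => cos (ln x * t)) by exact: (measurableT_comp measurable_cosT).
have ms : measurable_fun setT (fun x : mT => sin (ln x * t)) by exact: (measurableT_comp measurable_sinT).
have ic q : mu.-integrable setT (EFin \o weighted a q) ->
    mu.-integrable setT (fun x => (weighted a q x * cos (ln x * t))%:E).
  by move=> iq; apply: (integrable_mul_bounded measurableT mc _ iq) => x _; exact: normr_cos_le1.
have is_ q : mu.-integrable setT (EFin \o weighted a q) ->
    mu.-integrable setT (fun x => (weighted a q x * sin (ln x * t))%:E).
  by move=> iq; apply: (integrable_mul_bounded measurableT ms _ iq) => x _; exact: normr_sin_le1.
have ifg := integrable_tensor if_ ig.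
have mang : measurable_fun setT (fun z : mT * mT => (ln z.1 + ln z.2) * t).
  apply: measurable_funM => //; apply: measurable_funD.
    exact: (measurableT_comp (@measurable_ln R) measurable_fst).
  exact: (measurableT_comp (@measurable_ln R) measurable_snd).
split.
- rewrite -integral12_prod_meas1; last first.
    apply: (integrable_mul_bounded measurableT _ _ ifg).
      exact: (measurableT_comp measurable_cosT mang).
    by move=> z _; exact: normr_cos_le1.
  rewrite /fubini_F/=.
  rewrite (_ : Cf * Cg - Sf * Sg = Cg * Cf + - Sg * Sf); last by ring.
  rewrite -(integral_linear_combination _ _ (ic f if_) (is_ f if_)).
  apply: eq_integral => x _; rewrite (_ : Cg * _ + _ =
    weighted a f x * cos (ln x * t) * Cg + - (weighted a f x * sin (ln x * t)) * Sg);
    last by ring.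
  rewrite -(integral_linear_combination _ _ (ic g ig) (is_ g ig)).
  by apply: eq_integral => z _; congr EFin; rewrite mulrDl cosD; ring.
- rewrite -integral12_prod_meas1; last first.
    apply: (integrable_mul_bounded measurableT _ _ ifg).
      exact: (measurableT_comp measurable_sinT mang).
    by move=> z _; exact: normr_sin_le1.
  rewrite /fubini_F/=.
  rewrite (_ : Sf * Cg + Cf * Sg = Sg * Cf + Cg * Sf); last by ring.
  rewrite -(integral_linear_combination _ _ (ic f if_) (is_ f if_)).
  apply: eq_integral => x _; rewrite (_ : Sg * _ + _ =
    weighted a f x * sin (ln x * t) * Cg + (weighted a f x * cos (ln x * t)) * Sg);
    last by ring.
  rewrite -(integral_linear_combination _ _ (ic g ig) (is_ g ig)).
  by apply: eq_integral => z _; congr EFin; rewrite mulrDl sinD; ring.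
Qed.

End mellin_density.

Section law_of_product.
Context {R : realType}.
Local Notation mu := (@lebesgue_measure R).
Let mT := measurableTypeR R.
Context (f g : R -> R) (df : density f) (dg : density g).
Context d (Omega : measurableType d) (P : probability Omega R) (Y : {RV P >-> R}).
Hypothesis hY : has_density Y (mult_conv f g).

Let f0 := weighted 0 f.
Let g0 := weighted 0 g.

Let mf0 : measurable_fun setT f0.
Proof. by case: df => mf _ _; exact: measurable_weighted. Qed.

Let mg0 : measurable_fun setT g0.
Proof. by case: dg => mg _ _; exact: measurable_weighted. Qed.

Let f0_ge0 x : 0 <= f0 x.
Proof. by case: df => _ f_ge0 _; exact: weighted_ge0. Qed.

Let g0_ge0 x : 0 <= g0 x.
Proof. by case: dg => _ g_ge0 _; exact: weighted_ge0. Qed.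

(* [x `^ (-1)] is [x^-1] for [0 <= x], in a form known to be measurable. *)
Let kern (yx : mT * mT) : \bar R :=
  (f0 yx.2 * g0 (yx.1 * yx.2 `^ (-1)) * yx.2 `^ (-1))%:E.

Let kern_ge0 yx : (0 <= kern yx)%E.
Proof. by rewrite lee_fin !mulr_ge0// powR_ge0. Qed.

Let mkern : measurable_fun setT kern.
Proof.
have mp : measurable_fun setT (fun yx : mT * mT => yx.2 `^ (-1)).
  exact: (measurableT_comp (measurable_powR (-1)) measurable_snd).
apply/measurable_EFinP; apply: measurable_funM => //; apply: measurable_funM.
  exact: (measurableT_comp mf0 measurable_snd).
by apply: (measurableT_comp mg0); apply: measurable_funM.
Qed.

Let q (y : mT) : \bar R := (\int[mu]_x kern (y, x))%E.

Let q_ge0 y : (0 <= q y)%E.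
Proof. exact: integral_ge0. Qed.

Let mq : measurable_fun setT q.
Proof. exact: (measurable_fun_fubini_tonelli_F kern). Qed.

Let qE y : q y = if y \in Rpos then mult_conv f g y else 0%E.
Proof.
rewrite /mult_conv [in RHS]integral_mkcond; case: ifPn; rewrite in_Rpos.
  move=> y0; apply: eq_integral => x _; rewrite patchE in_Rpos /kern/=.
  have [x0|x0] := leP x 0; first by rewrite /f0 weighted_npos// !mul0r.
  rewrite powRN powRr1 ?(ltW x0)// /f0 /g0 !weighted_pos ?divr_gt0//.
  by rewrite !powRr0 !mul1r.
move=> y0; apply: integral0_eq => x _; rewrite /kern/=.
have [x0|x0] := leP x 0; first by rewrite /f0 weighted_npos// !mul0r.
rewrite /g0 weighted_npos ?mulr0 ?mul0r//.
by rewrite pmulr_lle0 ?powR_gt0// leNgt.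
Qed.

(** [Y] is distributed as a product of independent variables with densities [f] and [g]. After
    Tonelli, the substitution [y = x z] at fixed [x > 0] has Jacobian [x], which cancels the factor
    [x^-1] of the kernel. *)
Lemma ge0_integral_law (h : R -> \bar R) :
  measurable_fun setT h -> (forall y, 0 <= h y)%E ->
  (\int[P]_w h (Y w) =
   \int[mu]_x \int[mu]_z (h (x * z)%R * (f0 x * g0 z)%:E))%E.
Proof.
move=> mh h0.
have mY : measurable_fun setT (Y : Omega -> mT) by exact: (@measurable_funP _ _ _ _ _ Y).
transitivity (\int[pushforward P (Y : Omega -> mT)]_y h y)%E.
  by rewrite ge0_integral_pushforward.
rewrite (eq_measure_integral (density_measure mu mq q_ge0)); last first.
  move=> A mA _; rewrite /density_measure [LHS](hY mA) integral_mkcondr.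
  by apply: eq_integral => y _; rewrite qE patchE.
rewrite integral_density_measure//.
transitivity (\int[mu]_y \int[mu]_x (h y * kern (y, x)))%E.
  apply: eq_integral => y _; rewrite ge0_integralZl//.
  exact: (measurableT_comp mkern (pair1_measurable y)).
rewrite (@fubini_tonelli _ _ _ _ _ mu mu (fun z : mT * mT => h z.1 * kern z)%E)/=; last 2 first.
- apply: emeasurable_funM => //; exact: (measurableT_comp mh measurable_fst).
- by move=> z; rewrite mule_ge0.
apply: eq_integral => x _.
have [x0|x0] := leP x 0.
  rewrite !integral0_eq// => y _; rewrite /kern/= /f0 weighted_npos// !mul0r ?mule0//.
have x00 : x != 0 by rewrite gt_eqF.
have mhk : measurable_fun setT (fun y : mT => h y * kern (y, x))%E.
  apply: emeasurable_funM => //.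
  exact: (measurableT_comp mkern (pair2_measurable x)).
rewrite (ge0_integral_scale x0 mhk); last by move=> y; rewrite mule_ge0.
rewrite -ge0_integralZl//=; last 3 first.
- apply: (measurableT_comp mhk); exact: measurable_funM.
- by move=> y _; rewrite mule_ge0.
- by rewrite lee_fin ltW.
apply: eq_integral => z _; rewrite muleCA; congr (_ * _)%E.
rewrite /kern/= -EFinM; congr EFin.
by rewrite powRN powRr1 ?(ltW x0)// [x * z]mulrC mulfK//; field.
Qed.

End law_of_product.

Section moments_of_product.
Context {R : realType}.
Local Notation mu := (@lebesgue_measure R).
Let mT := measurableTypeR R.
Context (f g : R -> R) (df : density f) (dg : density g).
Context d (Omega : measurableType d) (P : probability Omega R) (Y : {RV P >-> R}).
Hypothesis hY : has_density Y (mult_conv f g).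

Let mY : measurable_fun setT (Y : Omega -> R).
Proof. exact: (@measurable_funP _ _ _ _ _ Y). Qed.

Section first_moment.
Context (a : R).
Hypothesis if_ : mu.-integrable setT (EFin \o weighted a f).
Hypothesis ig : mu.-integrable setT (EFin \o weighted a g).

Let mln2 : measurable_fun setT (fun z : mT * mT => ln z.1 + ln z.2).
Proof.
apply: measurable_funD.
  exact: (measurableT_comp (@measurable_ln R) measurable_fst).
exact: (measurableT_comp (@measurable_ln R) measurable_snd).
Qed.

Let measurable_powR_ln (k : R -> R) : measurable_fun setT k ->
  measurable_fun setT (fun y => y `^ a * k (ln y)).
Proof.
move=> mk; apply: measurable_funM; first exact: (measurable_powR a).
exact: (measurableT_comp mk (@measurable_ln R)).
Qed.

(** For positive [x] and [z], [(x z)^a = x^a z^a] distributes the weight over the two densities and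
    [ln (x z) = ln x + ln z]; elsewhere both integrands vanish. *)
Let ge0_law (k : R -> R) : measurable_fun setT k -> (forall x, 0 <= k x) ->
  (\int[P]_w (Y w `^ a * k (ln (Y w)))%:E =
   \int[(mu \x mu)%E]_z (weighted a f z.1 * weighted a g z.2 *
     k (ln z.1 + ln z.2))%:E)%E.
Proof.
move=> mk k0.
rewrite (ge0_integral_law df dg hY (h := fun y => (y `^ a * k (ln y))%:E)); last 2 first.
- by apply/measurable_EFinP; exact: measurable_powR_ln.
- by move=> y; rewrite lee_fin mulr_ge0 ?powR_ge0.
have [mf f_ge0 _] := df; have [mg g_ge0 _] := dg.
rewrite fubini_tonelli1; last 2 first.
- apply/measurable_EFinP; apply: measurable_funM; last exact: (measurableT_comp mk mln2).
  apply: measurable_funM.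
    exact: (measurableT_comp (measurable_weighted a mf) measurable_fst).
  exact: (measurableT_comp (measurable_weighted a mg) measurable_snd).
- by move=> z; rewrite lee_fin !mulr_ge0 ?weighted_ge0.
apply: eq_integral => x _; apply: eq_integral => z _; rewrite -EFinM; congr EFin => /=.
have [x0|x0] := leP x 0; first by rewrite [weighted 0 f x]weighted_npos//
  [weighted a f x]weighted_npos// !mul0r mulr0.
have [z0|z0] := leP z 0.
  by rewrite [weighted 0 g z]weighted_npos// [weighted a g z]weighted_npos// !mulr0 mul0r.
by rewrite !weighted_pos// !powRr0 powRM ?ltW// lnM//; ring.
Qed.

(* The signed case follows from the nonnegative one applied to [1] and [1 + k]. *)
Lemma integral_law_bounded (k : R -> R) : measurable_fun setT k ->
  (forall x, `|k x| <= 1) ->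
  P.-integrable setT (fun w => (Y w `^ a * k (ln (Y w)))%:E) /\
  (\int[P]_w (Y w `^ a * k (ln (Y w)))%:E =
   \int[(mu \x mu)%E]_z (weighted a f z.1 * weighted a g z.2 *
     k (ln z.1 + ln z.2))%:E)%E.
Proof.
move=> mk k1; have ifg := integrable_tensor if_ ig.
have k1_ge0 x : 0 <= 1 + k x by have := k1 x; rewrite ler_norml => /andP[]; lra.
have ifgk : (mu \x mu)%E.-integrable setT (fun z => (weighted a f z.1 * weighted a g z.2 *
     k (ln z.1 + ln z.2))%:E).
  apply: (integrable_mul_bounded measurableT _ _ ifg); last by move=> z _; exact: k1.
  exact: (measurableT_comp mk mln2).
have Ea : (\int[P]_w (Y w `^ a)%:E =
    \int[(mu \x mu)%E]_z (weighted a f z.1 * weighted a g z.2)%:E)%E.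
  have := ge0_law (@measurable_cst _ _ _ _ setT (1 : R)) (fun=> ler01).
  by under eq_integral do rewrite mulr1; under [in X in _ = X -> _]eq_integral do rewrite mulr1.
have ia : P.-integrable setT (fun w => (Y w `^ a)%:E).
  apply/integrableP; split.
    apply/measurable_EFinP; exact: (measurableT_comp (measurable_powR a) mY).
  under eq_integral do rewrite gee0_abs ?lee_fin ?powR_ge0//.
  by rewrite Ea; exact: integrable_lty ifg.
have iak : P.-integrable setT (fun w => (Y w `^ a * k (ln (Y w)))%:E).
  apply: (integrable_mul_bounded measurableT _ _ ia); last by move=> w _; exact: k1.
  exact: (measurableT_comp mk (measurableT_comp (@measurable_ln R) mY)).
split=> //.
have := ge0_law (measurable_funD (@measurable_cst _ _ _ _ setT (1 : R)) mk) k1_ge0.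
under eq_integral do rewrite /= mulrDr mulr1 EFinD.
under [in X in _ = X -> _]eq_integral do rewrite /= mulrDr mulr1 EFinD.
rewrite (integralD measurableT ia iak) (integralD measurableT ifg ifgk) Ea.
(* The term common to both sides can be cancelled because all three integrals are finite. *)
have finA := integrable_fin_num measurableT ifg.
have finX := integrable_fin_num measurableT iak.
have finY := integrable_fin_num measurableT ifgk.
by rewrite -(fineK finA) -(fineK finX) -(fineK finY) -!EFinD => -[/addrI ->].
Qed.

End first_moment.

(** At fixed [x > 0], [z^(2c-2) g(z) <= G / z] almost everywhere, so the integral in [z] is at most
    [x^(2c-2) f(x) G] times that of [H (ln (x z))^2 dz / z]. The measure [dz / z] is invariant under
    scaling, so the latter is [int H^2] whatever [x] is, and integrating in [x] produces [sigma]. *)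
Lemma second_moment_law (c G sigma : R) (H : R -> R) : 0 <= G ->
  {ae mu, forall z, 0 < z -> z `^ (2 * c - 1) * g z <= G} ->
  expect_density f (fun x => x `^ (2 * (c - 1))) = sigma%:E ->
  measurable_fun setT H ->
  (\int[P]_w ((Y w `^ (c - 1) * H (ln (Y w))) ^+ 2)%:E <=
   (G * sigma)%:E * \int[mu]_u (H u ^+ 2)%:E)%E.
Proof.
move=> G0 gG fs mH.
have [mf f_ge0 _] := df; have [mg g_ge0 _] := dg.
have mA : measurable_fun setT (fun y => (y `^ (c - 1) * H (ln y)) ^+ 2).
  apply: measurable_funX; apply: measurable_funM; first exact: (measurable_powR (c - 1)).
  exact: (measurableT_comp mH (@measurable_ln R)).
rewrite (ge0_integral_law df dg hY (h := fun y => ((y `^ (c - 1) * H (ln y)) ^+ 2)%:E)); last 2 first.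
- exact/measurable_EFinP.
- by move=> y; rewrite lee_fin sqr_ge0.
(* [L y dy] is the image of [H u ^+ 2 du] under [y = e^u]; the indicator discards the values of [ln]
   at nonpositive arguments. *)
pose L (y : mT) : \bar R := ((y `^ (-1) * H (ln y) ^+ 2)%:E * (\1_(@Rpos R) y)%:E)%E.
have L0 y : (0 <= L y)%E.
  by apply: mule_ge0; rewrite lee_fin// mulr_ge0 ?powR_ge0 ?sqr_ge0.
have mL : measurable_fun setT L.
  apply: emeasurable_funM; last first.
    by apply/measurable_EFinP; apply: measurable_indic; exact: measurable_Rpos.
  apply/measurable_EFinP; apply: measurable_funM; first exact: (measurable_powR (-1)).
  by apply: measurable_funX; exact: (measurableT_comp mH (@measurable_ln R)).
have intL : (\int[mu]_y L y = \int[mu]_u (H u ^+ 2)%:E)%E.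
  transitivity (\int[mu]_(y in `]0%R, +oo[) L y)%E.
    rewrite [RHS]integral_mkcond; apply: eq_integral => y _.
    rewrite patchE -[_ \in _]/(y \in @Rpos R) ; case: ifPn => // yR.
    by rewrite /L indicE (negbTE yR) mule0.
  rewrite ge0_integral_expR//; apply: eq_integral => u _.
  rewrite /L indicE in_Rpos expR_gt0 mule1 -EFinM expRK.
  by rewrite powRN powRr1 ?expR_ge0// mulrAC mulVf ?mul1r// gt_eqF// expR_gt0.
pose F := weighted (2 * (c - 1)) f.
have intF : (\int[mu]_x (F x)%:E = sigma%:E)%E by rewrite /F integral_weighted.
apply: (@le_trans _ _ (\int[mu]_x ((F x * G)%:E * \int[mu]_u (H u ^+ 2)%:E))%E); last first.
  rewrite ge0_integralZr//; last 3 first.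
  - apply/measurable_EFinP/measurable_funM => //; exact: measurable_weighted.
  - by move=> x _; rewrite lee_fin mulr_ge0// weighted_ge0.
  - by apply: integral_ge0 => u _; rewrite lee_fin sqr_ge0.
  under eq_integral do rewrite EFinM.
  rewrite ge0_integralZr//; last 2 first.
  - apply/measurable_EFinP; exact: measurable_weighted.
  - by move=> x _; rewrite lee_fin weighted_ge0.
  by rewrite intF -EFinM mulrC.
pose J (xz : mT * mT) : \bar R :=
  ((((xz.1 * xz.2) `^ (c - 1) * H (ln (xz.1 * xz.2))) ^+ 2)%:E *
   (weighted 0 f xz.1 * weighted 0 g xz.2)%:E)%E.
have J0 xz : (0 <= J xz)%E.
  by rewrite /J -EFinM lee_fin mulr_ge0 ?sqr_ge0// mulr_ge0// weighted_ge0.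
have mint : measurable_fun setT J.
  apply: emeasurable_funM.
    apply/measurable_EFinP; apply: (measurableT_comp mA); apply: measurable_funM.
      exact: measurable_fst.
    exact: measurable_snd.
  apply/measurable_EFinP; apply: measurable_funM.
    exact: (measurableT_comp (measurable_weighted 0 mf) measurable_fst).
  exact: (measurableT_comp (measurable_weighted 0 mg) measurable_snd).
apply: ge0_le_integral => //.
- by move=> x _; apply: integral_ge0 => z _; exact: (J0 (x, z)).
- exact: (measurable_fun_fubini_tonelli_F J).
- apply: emeasurable_funM => //; apply/measurable_EFinP/measurable_funM => //.
  exact: measurable_weighted.
move=> x _.
have [x0|x0] := leP x 0.
  rewrite /F [in leRHS]weighted_npos// mul0r mul0e integral0_eq// => z _.
  by rewrite weighted_npos// mul0r mule0.
rewrite -intL (ge0_integral_scale x0 mL L0) muleA -EFinM.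
rewrite -ge0_integralZl//; last 2 first.
- by apply: (measurableT_comp mL); exact: measurable_funM.
- by rewrite lee_fin !mulr_ge0 ?weighted_ge0// ltW.
apply: ae_ge0_le_integral => //.
- by move=> z _; exact: (J0 (x, z)).
- exact: (measurableT_comp mint (pair1_measurable x)).
- by move=> z _; rewrite mule_ge0// lee_fin !mulr_ge0 ?weighted_ge0// ltW.
- apply: emeasurable_funM => //.
  by apply: (measurableT_comp mL); exact: measurable_funM.
move: gG; apply: filterS; first exact: (ae_filter_ringOfSetsType mu).
move=> z gz _.
rewrite -EFinM /L indicE in_Rpos.
have [z0|z0] := leP z 0.
  rewrite [weighted 0 g z]weighted_npos// !mulr0 mule_ge0//.
    by rewrite lee_fin !mulr_ge0 ?weighted_ge0// ltW.
  by apply: mule_ge0; rewrite lee_fin// mulr_ge0 ?powR_ge0 ?sqr_ge0.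
rewrite pmulr_rgt0// z0 mule1 -EFinM lee_fin /F !weighted_pos// !powRr0 !mul1r.
have xz0 : 0 < x * z by rewrite mulr_gt0.
have pE y : 0 < y -> (y `^ (c - 1)) ^+ 2 = y `^ (2 * (c - 1)).
  by move=> y0; rewrite -powR_mulrn ?powR_ge0// -powRrM mulrC.
rewrite exprMn pE// powRM ?(ltW x0) ?(ltW z0)// [(x * z) `^ (-1)]powRN powRr1 ?(ltW xz0)//.
have -> : z `^ (2 * (c - 1)) = z `^ (2 * c - 1) / z.
  rewrite -[X in _ / X](@powRr1 _ z) ?(ltW z0)// -powRB; first by congr (_ `^ _); ring.
  by apply/implyP => _; rewrite gt_eqF.
set X := x `^ _; set Z := z `^ _; set h := H _ ^+ 2.
have -> : X * (Z / z) * h * (f x * g z) = X * f x * h / z * (Z * g z) by ring.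
have -> : X * f x * G * x * ((x * z)^-1 * h) = X * f x * h / z * G.
  by field; rewrite !gt_eqF.
apply: ler_wpM2l; last exact: gz.
apply: divr_ge0; last exact: ltW.
by apply: mulr_ge0; [apply: mulr_ge0; [exact: powR_ge0|exact: f_ge0]|exact: sqr_ge0].
Qed.

End moments_of_product.

(** * Bias and risk *)

Section tail.
Context {R : realType}.
Local Notation mu := (@lebesgue_measure R).

(** Monotone convergence along integer intervals yields one [N] for which the mass of [|q|] off
    [[-N, N]] is at most [e]; for real [k >= N] the mass off [[-k, k]] is no larger. *)
Lemma Rintegral_tail (q : R -> R) (e : R) : mu.-integrable setT (EFin \o q) -> 0 < e ->
  exists2 k0, 0 < k0 & forall k, k0 <= k ->
    `|Rintegral mu `[- k, k] q - Rintegral mu setT q| <= e.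
Proof.
move=> iq e0.
have mq : measurable_fun setT q by apply/measurable_EFinP; exact: measurable_int iq.
pose aq (x : R) : R := `|q x|.
have iaq : mu.-integrable setT (EFin \o aq) by exact: (integrable_abse iq).
pose F (n : nat) : set (measurableTypeR R) := `[- n%:R, n%:R]%classic.
have mF n : measurable (F n) by exact: measurable_itv.
have ik (h : R -> R) (A : set (measurableTypeR R)) : measurable A -> mu.-integrable setT (EFin \o h) ->
    mu.-integrable A (EFin \o h).
  by move=> mA ih; apply: (integrableS measurableT mA (@subsetT _ A) ih).
have Fi n : mu.-integrable (F n) (EFin \o aq) by exact: (ik aq (F n) (mF n) iaq).
have ndF : {homo F : n m / (n <= m)%N >-> (n <= m)%O}.
  move=> n m nm; apply/subsetPset; apply: subset_itv; rewrite bnd_simp ?lerN2 ler_nat//.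
have UF : \bigcup_n F n = setT.
  apply/seteqP; split => // x _; exists (Num.truncn `|x|).+1 => //=.
  by rewrite /F/= in_itv/= -ler_norml ltW// truncnS_gt.
have cvgF : (\int[mu]_(x in F n) (aq x)%:E)%E @[n --> \oo] --> (\int[mu]_x (aq x)%:E)%E.
  rewrite -UF; apply: ge0_nondecreasing_set_cvg_integral => //.
  - move=> n; apply/measurable_EFinP; apply: measurable_funTS.
    exact: (measurableT_comp (@normr_measurable R setT) mq).
  - by move=> n x _; rewrite lee_fin /aq.
have finF n := integrable_fin_num (mF n) (Fi n).
have := cvgF; rewrite -(fineK (integrable_fin_num measurableT iaq)) => /fine_cvgP[_].
move=> /cvgrPdist_le/(_ e e0)[N _ /(_ N (leqnn N))] /= le_e.
(* The successor makes the threshold positive even if [N = 0]. *)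
exists N.+1%:R => // k Nk.
pose K : set (measurableTypeR R) := `[- k, k]%classic.
have mk : measurable K by exact: measurable_itv.
rewrite -/K.
have split_k (h : R -> R) : mu.-integrable setT (EFin \o h) ->
    Rintegral mu setT h = Rintegral mu K h + Rintegral mu (~` K) h.
  move=> ih; rewrite -Rintegral_setU ?setUv//; first exact: measurableC.
  exact/disj_setPCl.
rewrite (split_k q iq) opprD addrA subrr sub0r normrN.
have mCk : measurable (~` K) by exact: measurableC.
rewrite (le_trans (le_normr_Rintegral mCk (ik _ _ mCk iq)))//.
have -> : Rintegral mu (~` K) (fun x => `|q x|) =
    Rintegral mu setT aq - Rintegral mu K aq.
  by rewrite (split_k aq iaq) addrAC subrr add0r.
apply: le_trans le_e; apply: le_trans (ler_norm _); rewrite lerD2l lerN2.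
apply: fine_le; rewrite ?finF ?integrable_fin_num//; first exact: (ik _ _ mk iaq).
apply: ge0_subset_integral => //.
  by apply/measurable_EFinP; exact: measurable_funTS (measurableT_comp (@normr_measurable R setT) mq).
  by move=> x _; rewrite lee_fin /aq.
have Nk' : N%:R <= k by rewrite (le_trans _ Nk)// ler_nat.
by rewrite /F /K; apply: subset_itv; rewrite bnd_simp ?lerN2.
Qed.

(** A null set of the restricted measure becomes Lebesgue null once intersected with [Rpos], and
    only points [z > 0] can violate the bound. The maximum with 0 makes [G] nonnegative. *)
Lemma ess_sup_bound (a : R) (g : R -> R) : (weighted_ess_sup a g < +oo)%E ->
  exists2 G, 0 <= G & {ae mu, forall z, 0 < z -> z `^ a * g z <= G}.
Proof.
move=> supoo; pose G := Num.max 0 (fine (weighted_ess_sup a g)).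
exists G; first by rewrite le_max lexx.
have := ess_sup_ge (mrestr mu measurable_Rpos) (fun x => (x `^ a * g x)%:E).
rewrite -/(weighted_ess_sup a g) => -[A [mA A0 subA]].
exists (A `&` @Rpos R); split.
- by apply: measurableI => //; exact: measurable_Rpos.
- exact: A0.
move=> z /= Gz.
have z0 : 0 < z by apply: contrapT => z0; apply: Gz => z1; case: z0.
split; last by rewrite /Rpos/= in_itv/= andbT.
apply: subA => /= le_sup; apply: Gz => _.
move: supoo le_sup; rewrite /G; case: (weighted_ess_sup a g) => [r _|//|_].
- by rewrite lee_fin => le_r; rewrite /= le_max le_r orbT.
- by rewrite leeNy_eq.
Qed.

End tail.

(** * Real and imaginary parts, and measurability of complex functions *)

Section complex_parts.
Context {R : realType}.
Implicit Types z w : R[i].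

Lemma sqr_normc z : Normc.normc z ^+ 2 = complex.Re z ^+ 2 + complex.Im z ^+ 2.
Proof. by case: z => x y; rewrite /= sqr_sqrtr// addr_ge0 ?sqr_ge0. Qed.

Lemma complexRe_mul z w : complex.Re (z * w) =
  complex.Re z * complex.Re w - complex.Im z * complex.Im w.
Proof. by case: z w => [x y] [u v]. Qed.

Lemma complexIm_mul z w : complex.Im (z * w) =
  complex.Re z * complex.Im w + complex.Im z * complex.Re w.
Proof. by case: z w => [x y] [u v]; rewrite /=. Qed.

(** The inverse is written as a real power because [measurable_powR] then gives measurability, zeros
    of [z] included. *)
Lemma Re_inv z : complex.Re z^-1 = complex.Re z * (Normc.normc z ^+ 2) `^ (-1).
Proof.
rewrite powR_inv1 ?sqr_ge0// sqr_normc; by case: z.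
Qed.

Lemma Im_inv z : complex.Im z^-1 = - complex.Im z * (Normc.normc z ^+ 2) `^ (-1).
Proof.
rewrite powR_inv1 ?sqr_ge0// sqr_normc; case: z => x y /=; by rewrite mulNr.
Qed.

Lemma cmeasurableM (D : set R) (h1 h2 : R -> R[i]) :
  cmeasurable D h1 -> cmeasurable D h2 -> cmeasurable D (fun t => h1 t * h2 t).
Proof.
move=> [r1 i1] [r2 i2]; split.
  under eq_fun do rewrite complexRe_mul.
  by apply: measurable_funB; apply: measurable_funM.
under eq_fun do rewrite complexIm_mul.
by apply: measurable_funD; apply: measurable_funM.
Qed.

Lemma measurable_sqr_normc (D : set R) (h : R -> R[i]) : cmeasurable D h ->
  measurable_fun D (fun t => Normc.normc (h t) ^+ 2).
Proof.
move=> [r i]; under eq_fun do rewrite sqr_normc.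
by apply: measurable_funD; apply: measurable_funX.
Qed.

Lemma cmeasurableV (D : set R) (h : R -> R[i]) :
  cmeasurable D h -> cmeasurable D (fun t => (h t)^-1).
Proof.
move=> mh; have mn := measurable_sqr_normc mh; have [r i] := mh.
have mp := measurableT_comp (measurable_powR (-1)) mn.
split.
  by under eq_fun do rewrite Re_inv; apply: measurable_funM.
under eq_fun do rewrite Im_inv.
by apply: measurable_funM => //; exact: measurableT_comp.
Qed.

Lemma cmeasurable_conj (D : set R) (h : R -> R[i]) :
  cmeasurable D h -> cmeasurable D (fun t => conjc (h t)).
Proof.
move=> [r i]; split.
  suff -> : (fun t => complex.Re (conjc (h t))) = (fun t => complex.Re (h t)) by [].
  by apply/funext => t; case: (h t).
suff -> : (fun t => complex.Im (conjc (h t))) = (fun t => - complex.Im (h t)).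
  exact: measurableT_comp.
by apply/funext => t; case: (h t).
Qed.

Lemma normc_conj z : Normc.normc (conjc z) = Normc.normc z.
Proof. by case: z => x y; rewrite /= sqrrN. Qed.

End complex_parts.

(** * Mean and second moment of a single summand *)

Section spectral_statistic.
Context {R : realType}.
Local Notation mu := (@lebesgue_measure R).
Let mT := measurableTypeR R.

(** One real component of [int phi(t) y^(c-1+it) dt]: the real part for
    [(a, b) = (Re phi, - Im phi)], the imaginary part for [(Im phi, Re phi)]. *)
Definition spectral_stat (c : R) (a b : R -> R) (y : R) : R :=
  y `^ (c - 1) * (cos_transform a (ln y) + sin_transform b (ln y)).

Context (c : R) (a b : R -> R).
Hypotheses (ia : mu.-integrable setT (EFin \o a))
           (ib : mu.-integrable setT (EFin \o b)).

Let measurable_spectrum :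
  measurable_fun setT (fun u => cos_transform a u + sin_transform b u).
Proof.
apply: measurable_funD.
  exact: measurable_cos_transform.
exact: measurable_sin_transform.
Qed.

Lemma measurable_spectral_stat : measurable_fun setT (spectral_stat c a b).
Proof.
apply: measurable_funM; first exact: (measurable_powR (c - 1)).
exact: (measurableT_comp measurable_spectrum (@measurable_ln R)).
Qed.

Context (f g : R -> R) (df : density f) (dg : density g).
Hypotheses (Lf : wLp 1 (c - 1) (cfun f)) (Lg : wLp 1 (c - 1) (cfun g)).
Context d (Omega : measurableType d) (P : probability Omega R) (Y : {RV P >-> R}).
Hypothesis hY : has_density Y (mult_conv f g).

Let mY : measurable_fun setT (Y : Omega -> R).
Proof. exact: (@measurable_funP _ _ _ _ _ Y). Qed.

(** In [4 * pi], one factor 2 comes from [(x + w)^2 <= 2 (x^2 + w^2)], applied to the sum of the two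
    transforms, and [2 * pi] from Plancherel. *)
Lemma second_moment_spectral_stat (G sigma : R) : 0 <= G -> 0 <= sigma ->
  {ae mu, forall z, 0 < z -> z `^ (2 * c - 1) * g z <= G} ->
  expect_density f (fun x => x `^ (2 * (c - 1))) = sigma%:E ->
  (\int[P]_w (spectral_stat c a b (Y w) ^+ 2)%:E <=
   (4 * pi * G * sigma)%:E *
   (\int[mu]_t (a t ^+ 2)%:E + \int[mu]_t (b t ^+ 2)%:E))%E.
Proof.
move=> G0 s0 gG fs.
apply: (le_trans (second_moment_law df dg hY G0 gG fs measurable_spectrum)).
pose Q (h : R -> R) u := cos_transform h u ^+ 2 + sin_transform h u ^+ 2.
have Q0 h u : 0 <= Q h u by rewrite addr_ge0 ?sqr_ge0.
have mQ h : mu.-integrable setT (EFin \o h) -> measurable_fun setT (EFin \o Q h).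
  move=> ih; apply/measurable_EFinP/measurable_funD; apply: measurable_funX.
    exact: measurable_cos_transform.
  exact: measurable_sin_transform.
have le_H : (\int[mu]_u ((cos_transform a u + sin_transform b u) ^+ 2)%:E <=
    2%:E * (\int[mu]_u (Q a u)%:E + \int[mu]_u (Q b u)%:E))%E.
  have mQa := mQ a ia; have mQb := mQ b ib.
  rewrite -ge0_integralD//; last 2 first.
  - by move=> u _; rewrite lee_fin.
  - by move=> u _; rewrite lee_fin.
  rewrite -ge0_integralZl//; last 2 first.
  - exact: emeasurable_funD.
  - by move=> u _; rewrite adde_ge0 ?lee_fin ?Q0.
  apply: ge0_le_integral => //.
  - by move=> u _; rewrite lee_fin sqr_ge0.
  - exact/measurable_EFinP/measurable_funX.
  - by apply: emeasurable_funM => //; exact: emeasurable_funD.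
  move=> u _; rewrite -EFinD -EFinM lee_fin /Q.
  move: (cos_transform a u) (sin_transform a u) (cos_transform b u) (sin_transform b u) => x y z w.
  have := sqr_ge0 (x - w); have := sqr_ge0 y; have := sqr_ge0 z; nra.
have {}le_H : (\int[mu]_u ((cos_transform a u + sin_transform b u) ^+ 2)%:E <=
    2%:E * ((2 * pi)%:E * (\int[mu]_t (a t ^+ 2)%:E) + (2 * pi)%:E * (\int[mu]_t (b t ^+ 2)%:E)))%E.
  rewrite (le_trans le_H)// lee_wpmul2l//.
  by apply: leeD; [exact: (plancherel_le ia)|exact: (plancherel_le ib)].
apply: le_trans (lee_wpmul2l _ le_H) _; first by rewrite lee_fin mulr_ge0.
rewrite -ge0_muleDr; try by apply: integral_ge0 => t _; rewrite lee_fin sqr_ge0.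
rewrite !muleA -!EFinM (_ : G * sigma * 2 * (2 * pi) = 4 * pi * G * sigma)//; ring.
Qed.

(** Fubini between [w] and [t], justified by the integrability of [Y^(c-1) h(t)] on the product
    space; [k] stands for [cos] or [sin]. *)
Let angle_mean (h k : R -> R) :
  mu.-integrable setT (EFin \o h) -> measurable_fun setT k -> (forall x, `|k x| <= 1) ->
  P.-integrable setT (fun w => (Y w `^ (c - 1) *
    Rintegral mu setT (fun t => h t * k (t * ln (Y w))))%:E) /\
  mu.-integrable setT
    (fun t => (h t)%:E * \int[P]_w (Y w `^ (c - 1) * k (t * ln (Y w)))%:E)%E /\
  (\int[P]_w (Y w `^ (c - 1) * Rintegral mu setT (fun t => h t * k (t * ln (Y w))))%:E =
   \int[mu]_t ((h t)%:E * \int[P]_w (Y w `^ (c - 1) * k (t * ln (Y w)))%:E))%E.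
Proof.
move=> ih mk k1.
have if_ := integrable_weighted df Lf; have ig := integrable_weighted dg Lg.
have norm1 (x : R) : `|cst (1 : R) x| <= 1 by rewrite normr1.
have [ip _] := integral_law_bounded df dg hY if_ ig (@measurable_cst _ _ _ _ setT (1 : R))
  norm1.
have {}ip : P.-integrable setT (fun w => (Y w `^ (c - 1))%:E).
  by under eq_fun do rewrite -[_ `^ _]mulr1.
have iph := integrable_tensor ip ih.
have mlnY : measurable_fun setT (fun w : Omega => ln (Y w)).
  exact: (measurableT_comp (@measurable_ln R) mY).
have intF : (P \x mu)%E.-integrable setT (fun wt : Omega * mT =>
    (Y wt.1 `^ (c - 1) * h wt.2 * k (wt.2 * ln (Y wt.1)))%:E).
  apply: (integrable_mul_bounded measurableT _ _ iph); last by move=> z _; exact: k1.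
  apply: (measurableT_comp mk); apply: measurable_funM; first exact: measurable_snd.
  exact: (measurableT_comp mlnY measurable_fst).
(* The same integrand with its variables exchanged, from which the integrability in [t] of the inner
   mean is read off. *)
have iphh := integrable_tensor ih ip.
have intG : (mu \x P)%E.-integrable setT (fun tw : mT * Omega =>
    (h tw.1 * Y tw.2 `^ (c - 1) * k (tw.1 * ln (Y tw.2)))%:E).
  apply: (integrable_mul_bounded measurableT _ _ iphh); last by move=> z _; exact: k1.
  apply: (measurableT_comp mk); apply: measurable_funM; first exact: measurable_fst.
  exact: (measurableT_comp mlnY measurable_snd).
have ihk u : mu.-integrable setT (fun t => (h t * k (t * u))%:E).
  apply: (integrable_mul_bounded measurableT _ _ ih) => //.
  by apply: (measurableT_comp mk); exact: measurable_funM.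
have innerE w : (\int[mu]_t (Y w `^ (c - 1) * h t * k (t * ln (Y w)))%:E =
    (Y w `^ (c - 1) * Rintegral mu setT (fun t => h t * k (t * ln (Y w))))%:E)%E.
  under eq_integral do rewrite -mulrA EFinM.
  by rewrite integralZl// (EFin_Rintegral measurableT (ihk _)).
have outerE t : (\int[P]_w (Y w `^ (c - 1) * h t * k (t * ln (Y w)))%:E =
    (h t)%:E * \int[P]_w (Y w `^ (c - 1) * k (t * ln (Y w)))%:E)%E.
  rewrite -integralZl//.
    by apply: eq_integral => w _; rewrite -EFinM; congr EFin; ring.
  apply: (integrable_mul_bounded measurableT _ _ ip); last by move=> w _; exact: k1.
  by apply: (measurableT_comp mk); exact: measurable_funM.
split; last split.
- have := integrable_fubini_F intF; rewrite /fubini_F/=.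
  by under eq_fun do rewrite innerE.
- have := integrable_fubini_F intG; rewrite /fubini_F/=.
  under eq_fun => t.
    under eq_integral do rewrite [h t * _]mulrC.
    rewrite outerE; over.
  by [].
have := Fubini intF; rewrite /=.
under eq_integral do rewrite innerE.
by move=> ->; apply: eq_integral => t _; rewrite outerE.
Qed.

(** The mean of [Y^(c-1+it)] is [M_c[f](t) M_c[g](t)]: its real part is the mean with [cos], its
    imaginary part the mean with [sin]. *)
Lemma mean_spectral_stat :
  (\int[P]_w (spectral_stat c a b (Y w))%:E =
   \int[mu]_t (a t * complex.Re (mellin c (cfun f) t * mellin c (cfun g) t) +
     b t * complex.Im (mellin c (cfun f) t * mellin c (cfun g) t))%:E)%E.
Proof.
have if_ := integrable_weighted df Lf; have ig := integrable_weighted dg Lg.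
have [iA [ja EA]] := angle_mean ia measurable_cosT (@normr_cos_le1 R).
have [iB [jb EB]] := angle_mean ib measurable_sinT (@normr_sin_le1 R).
have mlt t : measurable_fun setT (fun u : R => u * t) by exact: measurable_funM.
have cosE t : (\int[P]_w (Y w `^ (c - 1) * cos (t * ln (Y w)))%:E =
    (complex.Re (mellin c (cfun f) t * mellin c (cfun g) t))%:E)%E.
  rewrite complexRe_mul !Re_mellin !Im_mellin.
  have [<- _] := integral_weighted_angle t if_ ig.
  have [_ <-] := integral_law_bounded df dg hY if_ ig (k := fun u => cos (u * t))
    (measurableT_comp (@measurable_cosT R) (mlt t)) (fun u => normr_cos_le1 _).
  by apply: eq_integral => w _; rewrite [t * _]mulrC.
have sinE t : (\int[P]_w (Y w `^ (c - 1) * sin (t * ln (Y w)))%:E =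
    (complex.Im (mellin c (cfun f) t * mellin c (cfun g) t))%:E)%E.
  rewrite complexIm_mul [X in _ = X%:E]addrC !Re_mellin !Im_mellin.
  have [_ <-] := integral_weighted_angle t if_ ig.
  have [_ <-] := integral_law_bounded df dg hY if_ ig (k := fun u => sin (u * t))
    (measurableT_comp (@measurable_sinT R) (mlt t)) (fun u => normr_sin_le1 _).
  by apply: eq_integral => w _; rewrite [t * _]mulrC.
under eq_integral do rewrite /spectral_stat mulrDr EFinD.
rewrite (integralD measurableT iA iB) EA EB.
rewrite -(integralD measurableT ja jb).
by apply: eq_integral => t _; rewrite cosE sinE EFinD !EFinM.
Qed.

End spectral_statistic.

(** * Truncation to [[-k, k]] and the empirical Mellin transform *)

Section truncation.
Context {R : realType}.
Local Notation mu := (@lebesgue_measure R).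
Let mT := measurableTypeR R.
Context (h : R -> R) (mh : measurable_fun setT h) (k : R).
Let K : set mT := `[- k, k]%classic.

Let mK : measurable K. Proof. exact: measurable_itv. Qed.

Lemma measurable_truncation : measurable_fun setT (h \_ K).
Proof.
apply/(measurable_restrictT _ _).1 => //; exact: measurable_funTS.
Qed.

Lemma integral_sqr_truncation_le :
  (\int[mu]_t ((h \_ K) t ^+ 2)%:E <= \int[mu]_t (h t ^+ 2)%:E)%E.
Proof.
apply: ge0_le_integral => //.
- by move=> t _; rewrite lee_fin sqr_ge0.
- apply/measurable_EFinP/measurable_funX; exact: measurable_truncation.
- exact/measurable_EFinP/measurable_funX.
move=> t _; rewrite lee_fin patchE; case: ifP => // _.
by rewrite expr0n/= sqr_ge0.
Qed.

(** On [K], [|h| <= 1 + h^2], so the truncation is dominated by the indicator of [K] plus [h^2]. *)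
Lemma integrable_truncation : (\int[mu]_t (h t ^+ 2)%:E < +oo)%E ->
  mu.-integrable setT (EFin \o (h \_ K)).
Proof.
move=> h2.
have i1 : mu.-integrable setT (EFin \o \1_K) by exact: integrable_indic_itv.
have i2 : mu.-integrable setT (EFin \o (fun t => h t ^+ 2)).
  apply/integrableP; split; first exact/measurable_EFinP/measurable_funX.
  by under eq_integral do rewrite /= ger0_norm ?sqr_ge0//.
apply: (le_integrable measurableT _ _ (integrable_addr measurableT i1 i2)).
  apply/measurable_EFinP; exact: measurable_truncation.
move=> t _; rewrite /= lee_fin patchE indicE.
have h0 := sqr_ge0 (h t).
rewrite [leRHS]ger0_norm ?addr_ge0//; case: ifP => _ /=; last first.
  by rewrite normr0 add0r.
rewrite -(real_normK (num_real (h t))).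
have := sqr_ge0 (`|h t| - 1); have := sqr_ge0 `|h t|; move: `|h t| => x; nra.
Qed.

End truncation.

Section empirical_estimator.
Context {R : realType}.
Local Notation mu := (@lebesgue_measure R).
Implicit Types (y : R).

Lemma natrC_inv (n : nat) : n%:R^-1 = Complex (n%:R^-1) 0 :> R[i].
Proof. by rewrite -[RHS]/((n%:R^-1 : R)%:C)%C fmorphV rmorph_nat. Qed.

Lemma Re_empirical_mellin c n (y : 'I_n -> R) t :
  complex.Re (empirical_mellin c y t) =
  n%:R^-1 * \sum_(j < n) y j `^ (c - 1) * cos (t * ln (y j)).
Proof.
rewrite /empirical_mellin natrC_inv complexRe_mul/= mul0r subr0; congr (_ * _).
by rewrite (big_morph (@complex.Re R) (id1 := 0) (op1 := +%R))// => -[? ?] [? ?].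
Qed.

Lemma Im_empirical_mellin c n (y : 'I_n -> R) t :
  complex.Im (empirical_mellin c y t) =
  n%:R^-1 * \sum_(j < n) y j `^ (c - 1) * sin (t * ln (y j)).
Proof.
rewrite /empirical_mellin natrC_inv complexIm_mul/= mul0r addr0; congr (_ * _).
by rewrite (big_morph (@complex.Im R) (id1 := 0) (op1 := +%R))// => -[? ?] [? ?].
Qed.

Lemma Rintegral_empirical_mellin c n (y : 'I_n -> R) (k : R) (p q : R -> R) :
  let K := `[- k, k]%classic in
  mu.-integrable setT (EFin \o (p \_ K)) -> mu.-integrable setT (EFin \o (q \_ K)) ->
  Rintegral mu K (fun t => p t * complex.Re (empirical_mellin c y t) +
                           q t * complex.Im (empirical_mellin c y t)) =
  n%:R^-1 * \sum_(j < n) spectral_stat c (p \_ K) (q \_ K) (y j).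
Proof.
move=> K ip iq; rewrite Rintegral_mkcond.
pose S j t := y j `^ (c - 1) *
  ((p \_ K) t * cos (t * ln (y j)) + (q \_ K) t * sin (t * ln (y j))).
have iS j : mu.-integrable setT (EFin \o S j).
  apply: integrable_scalel => //; apply: integrable_addr => //.
    exact: integrable_mul_cos.
  exact: integrable_mul_sin.
have intS j : Rintegral mu setT (S j) = spectral_stat c (p \_ K) (q \_ K) (y j).
  have ic := integrable_mul_cos ip (ln (y j)); have is_ := integrable_mul_sin iq (ln (y j)).
  rewrite (RintegralZl _ measurableT (integrable_addr measurableT ic is_)).
  by rewrite (RintegralD measurableT ic is_).
transitivity (Rintegral mu setT (fun t => n%:R^-1 * \sum_(j < n) S j t)).
  apply: eq_Rintegral => t _; rewrite /S.
  rewrite patchE [(p \_ K) t]patchE [(q \_ K) t]patchE; case: ifP => _; last first.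
    by rewrite big1 ?mulr0// => j _; rewrite !mul0r addr0 mulr0.
  rewrite Re_empirical_mellin Im_empirical_mellin mulrCA [q t * _]mulrCA -mulrDr; congr (_ * _).
  rewrite !mulr_sumr -big_split; apply: eq_bigr => j _ /=; ring.
have isum : mu.-integrable setT (EFin \o (fun t => \sum_(j < n) S j t)).
  rewrite (_ : EFin \o _ = fun t => (\sum_(j < n) (S j t)%:E)%E); last first.
    by apply/funext => t; rewrite /= sumEFin.
  by apply: integrable_sum => // j _; exact: iS.
rewrite RintegralZl//; congr (_ * _).
apply: EFin_inj; rewrite -(EFin_Rintegral measurableT isum).
under eq_integral do rewrite -sumEFin.
rewrite integral_sum//.
by rewrite -sumEFin; apply: eq_bigr => j _; rewrite (EFin_Rintegral measurableT (iS j)) intS.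
Qed.

End empirical_estimator.

Section risk.
Context {R : realType}.
Local Notation mu := (@lebesgue_measure R).
Context (c : R) (f g : R -> R) (df : density f) (dg : density g).
Hypotheses (Lf : wLp 1 (c - 1) (cfun f)) (Lg : wLp 1 (c - 1) (cfun g)).
Context (G sigma D : R) (G0 : 0 <= G) (sigma0 : 0 <= sigma).
Hypothesis gG : {ae mu, forall z, 0 < z -> z `^ (2 * c - 1) * g z <= G}.
Hypothesis fs : expect_density f (fun x => x `^ (2 * (c - 1))) = sigma%:E.

(** The risk of one real component, up to the factor [(2 pi)^-1]. The mean of the statistic is the
    integral of [r] over [[-k, k]], so the bias is a tail of [r]. The threshold is fixed before the
    sample and its probability space. *)
Lemma component_risk (p q r : R -> R) (e : R) :
  measurable_fun setT p -> measurable_fun setT q ->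
  (\int[mu]_t (p t ^+ 2)%:E + \int[mu]_t (q t ^+ 2)%:E <= D%:E)%E ->
  mu.-integrable setT (EFin \o r) ->
  (forall t, p t * complex.Re (mellin c (cfun f) t * mellin c (cfun g) t) +
     q t * complex.Im (mellin c (cfun f) t * mellin c (cfun g) t) = r t) ->
  0 < e ->
  exists2 k0, 0 < k0 & forall k, k0 <= k ->
    forall d (Omega : measurableType d) (P : probability Omega R) (n : nat)
      (Y : 'I_n -> {RV P >-> R}), (0 < n)%N -> iid_with_density Y (mult_conv f g) ->
    let X w := Rintegral mu `[- k, k] (fun t =>
      p t * complex.Re (empirical_mellin c (fun j => Y j w) t) +
      q t * complex.Im (empirical_mellin c (fun j => Y j w) t)) in
    measurable_fun setT X /\
    (\int[P]_w ((X w - Rintegral mu setT r) ^+ 2)%:E <=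
      ((4 * pi * G * sigma * D) / n%:R + e)%:E)%E.
Proof.
move=> mp mq pqD ir rE e0.
(* A bias of size at most [min 1 e] has square at most [e]. *)
pose del := Num.min 1 e.
have del0 : 0 < del by rewrite lt_min ltr01.
have [k0 k00 tail] := Rintegral_tail ir del0.
exists k0 => // k /tail {}tail d Omega P n Y n0 [indep law] X.
set K := `[- k, k]%classic in X tail *.
have p2 : (\int[mu]_t (p t ^+ 2)%:E < +oo)%E.
  apply: le_lt_trans (ltry D); apply: le_trans pqD.
  by rewrite leeDl// integral_ge0// => t _; rewrite lee_fin sqr_ge0.
have q2 : (\int[mu]_t (q t ^+ 2)%:E < +oo)%E.
  apply: le_lt_trans (ltry D); apply: le_trans pqD.
  by rewrite leeDr// integral_ge0// => t _; rewrite lee_fin sqr_ge0.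
have ip := integrable_truncation mp k p2.
have iq := integrable_truncation mq k q2.
have mh := measurable_spectral_stat c ip iq.
have XE w : X w = n%:R^-1 * \sum_(j < n) spectral_stat c (p \_ K) (q \_ K) (Y j w).
  exact: Rintegral_empirical_mellin.
have mX : measurable_fun setT X.
  rewrite (funext XE).
  apply: measurable_funM => //; apply: measurable_sum => j.
  exact: (measurableT_comp mh (@measurable_funP _ _ _ _ _ (Y j))).
split=> //.
under eq_integral do rewrite XE.
have irK : mu.-integrable (K : set (measurableTypeR R)) (EFin \o r).
  by apply: (integrableS measurableT _ _ ir) => //; exact: measurable_itv.
have Em j : (\int[P]_w (spectral_stat c (p \_ K) (q \_ K) (Y j w))%:E =
    (Rintegral mu K r)%:E)%E.
  rewrite (mean_spectral_stat ip iq df dg Lf Lg (law j)).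
  rewrite -(EFin_Rintegral _ irK); last exact: measurable_itv.
  rewrite [RHS]integral_mkcond; apply: eq_integral => t _.
  rewrite !patchE; case: ifP => _; first by rewrite rE.
  by rewrite !mul0r addr0.
have EV j : (\int[P]_w (spectral_stat c (p \_ K) (q \_ K) (Y j w) ^+ 2)%:E <=
    (4 * pi * G * sigma * D)%:E)%E.
  apply: (le_trans (second_moment_spectral_stat ip iq df dg (law j) G0 sigma0 gG fs)).
  rewrite [leRHS]EFinM lee_wpmul2l ?lee_fin ?mulr_ge0 ?pi_ge0//.
  by apply: le_trans pqD; apply: leeD; exact: integral_sqr_truncation_le.
apply: (le_trans (mean_square_error_le indep (Rintegral mu setT r) n0 mh EV Em)).
rewrite lee_fin lerD2l -(real_normK (num_real _)).
set x := `|_|; have x0 : 0 <= x by exact: normr_ge0.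
have : x <= Num.min 1 e by exact: tail.
by rewrite le_min => /andP[x1 xe]; nra.
Qed.

End risk.

Theorem proposition2p8 (R : realType) (c : R) (Psi : R -> R[i]) (g : R -> R)
    (sigma : R)
    (Psi_meas : cmeasurable setT Psi)
    (Psi_sym : forall t, conjc (Psi t) = Psi (- t))
    (g_dens : density g)
    (g_L1 : wLp 1 (c - 1) (cfun g))
    (g_mellin : forall t, mellin c (cfun g) t != 0)
    (g_bound : (weighted_ess_sup (2 * c - 1) g < +oo)%E)
    (cases :
      (* (i) *)
      (exists p gamma : R,
        [/\ smooth_functional Psi p, smooth_error c g gamma &
            1 < 2 * p - 2 * gamma]) \/
      (* (ii) *)
      ((exists p m r : R, super_smooth_functional Psi p m r) /\
       (exists gamma : R, smooth_error c g gamma)) \/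
      (* (iii) *)
      (exists p m r gamma lambda rho : R,
        [/\ super_smooth_functional Psi p m r,
            super_smooth_error c g gamma lambda rho &
            rho < r \/
            (r = rho /\ lambda < m) \/
            [/\ r = rho, m = lambda & 1 < 2 * p - 2 * gamma]])) :
  exists C : R, 0 < C /\
    forall f : R -> R,
      density f ->
      wLp 1 (c - 1) (cfun f) ->
      wLp 2 (2 * c - 1) (cfun f) ->
      Lp_real_line 1 (fun t => Psi t * mellin c (cfun f) t) ->
      expect_density f (fun x => x `^ (2 * (c - 1))) = sigma%:E ->
      (ereal_sup [set Delta c Psi g k | k in [set k : R | (0 < k)%R]] < +oo)%E /\
      forall n : nat, (0 < n)%N ->
        exists k0 : R, 0 < k0 /\
          forall k : R, k0 <= k ->
          forall (d : measure_display) (Omega : measurableType d)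
            (P : probability Omega R) (Y : 'I_n -> {RV P >-> R}),
            iid_with_density Y (mult_conv f g) ->
            ('E_P[(fun w => (Normc.normc (theta_hat c Psi g k (fun j => Y j w)
                                   - theta c Psi f) ^+ 2)%R)]
             <= (C / n%:R)%:E)%E.
Proof.
have mMg : cmeasurable setT (mellin c (cfun g)).
  by split; [exact: measurable_Re_mellin|exact: measurable_Im_mellin].
have [K [q [q1 ratio]]] := ratio_decay cases.
have [G G0 gG] := ess_sup_bound g_bound.
have K0 : 0 <= K.
  have := le_trans (sqr_ge0 _) (ratio 0).
  by rewrite pmulr_lge0// poly_decay_gt0.
pose I := fine (\int[@lebesgue_measure R]_t (poly_decay q t)%:E)%E.
have IE : (\int[@lebesgue_measure R]_t (poly_decay q t)%:E = I%:E)%E.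
  rewrite fineK// ge0_fin_numE ?integral_poly_decay_lty//.
  by apply: integral_ge0 => t _; rewrite lee_fin ltW// poly_decay_gt0.
(* Bounds [int |phi|^2] over the whole line, hence over every [[-k, k]]; it yields both the bound on
   [Delta] and the variance bound. *)
pose D := K * I.
have mratio : cmeasurable setT (fun t => Psi t / mellin c (cfun g) t).
  by apply: cmeasurableM => //; exact: cmeasurableV.
have mratio2 := measurable_sqr_normc mratio.
have leD : (\int[@lebesgue_measure R]_t
    (Normc.normc (Psi t / mellin c (cfun g) t) ^+ 2)%:E <= D%:E)%E.
  rewrite EFinM -IE -ge0_integralZl//; last 2 first.
  - apply/measurable_EFinP; exact: continuous_measurable_fun (@continuous_poly_decay R q).
  - by move=> t _; rewrite lee_fin ltW// poly_decay_gt0.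
  apply: ge0_le_integral => //.
  - by move=> t _; rewrite lee_fin sqr_ge0.
  - exact/measurable_EFinP.
  - apply: emeasurable_funM => //; apply/measurable_EFinP.
    exact: continuous_measurable_fun (@continuous_poly_decay R q).
  by move=> t _; rewrite -EFinM lee_fin.
have D0 : 0 <= D.
  rewrite -lee_fin; apply: le_trans leD.
  by apply: integral_ge0 => t _; rewrite lee_fin sqr_ge0.
clearbody D.
(* The constant is chosen before any [f] is given, and the sign of [sigma] is known only once some
   [f] realizes it; hence the absolute value. *)
pose v := 4 * pi * G * `|sigma| * D.
have v0 : 0 <= v by rewrite !mulr_ge0// pi_ge0.
(* Each of the two components contributes [v / n] for the variance and [1 / (2 n)] for the squared
   bias. *)
exists (2 * v + 1); split; first by rewrite ltr_wpDl// mulr_ge0.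
move=> f df Lf _ [_ LPsif] fs.
have sigma0 : 0 <= sigma.
  rewrite -lee_fin -fs; apply: integral_ge0 => x; rewrite /Rpos/= in_itv/= andbT => x0.
  by rewrite lee_fin mulr_ge0 ?powR_ge0//; case: df => _ + _; exact.
split.
  apply: (@le_lt_trans _ _ ((2 * pi)^-1 * D)%:E); last exact: ltry.
  apply: ge_ereal_sup => _ [k /= k0 <-].
  rewrite /Delta EFinM lee_wpmul2l ?lee_fin ?invr_ge0 ?mulr_ge0 ?pi_ge0//.
  apply: le_trans leD; apply: ge0_subset_integral => //.
  - exact/measurable_EFinP.
  - by move=> t _; rewrite lee_fin sqr_ge0.
move=> n n0.
have mMf : cmeasurable setT (mellin c (cfun f)).
  by split; [exact: measurable_Re_mellin|exact: measurable_Im_mellin].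
pose phi t := Psi (- t) / mellin c (cfun g) t.
have phiE t : phi t = conjc (Psi t) / mellin c (cfun g) t by rewrite /phi -Psi_sym.
have mphi : cmeasurable setT phi.
  rewrite (funext phiE); apply: cmeasurableM; last exact: cmeasurableV.
  exact: cmeasurable_conj.
(* [Psi (- t)] is the conjugate of [Psi t], so the reflection leaves the modulus unchanged. *)
have normphi t : Normc.normc (phi t) = Normc.normc (Psi t / mellin c (cfun g) t).
  by rewrite phiE !Normc.normcM normc_conj.
have [mphir mphii] := mphi.
have phi2 : (\int[@lebesgue_measure R]_t (complex.Re (phi t) ^+ 2)%:E +
    \int[@lebesgue_measure R]_t (complex.Im (phi t) ^+ 2)%:E <= D%:E)%E.
  rewrite -ge0_integralD//; last 4 first.
  - by move=> t _; rewrite lee_fin sqr_ge0.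
  - exact/measurable_EFinP/measurable_funX.
  - by move=> t _; rewrite lee_fin sqr_ge0.
  - exact/measurable_EFinP/measurable_funX.
  apply: le_trans leD; rewrite le_eqVlt; apply/orP; left; apply/eqP.
  by apply: eq_integral => t _; rewrite -EFinD -sqr_normc normphi.
pose psi t := Psi (- t) * mellin c (cfun f) t.
have mpsi : cmeasurable setT psi.
  rewrite /psi; under eq_fun do rewrite -Psi_sym.
  by apply: cmeasurableM => //; exact: cmeasurable_conj.
have [mpsir mpsii] := mpsi.
have normpsi t : Normc.normc (psi t) = Normc.normc (Psi t * mellin c (cfun f) t) `^ 1.
  by rewrite powRr1 ?normc_ge0// /psi -Psi_sym !Normc.normcM normc_conj.
have mnpsi : measurable_fun setT (fun t => Normc.normc (psi t)).
  under eq_fun do rewrite -(ger0_norm (normc_ge0 _)) -sqrtr_sqr.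
  apply: (@measurableT_comp _ _ _ _ _ _ (@Num.sqrt R)); last exact: measurable_sqr_normc.
  exact: continuous_measurable_fun (@sqrt_continuous R).
have ipsi : (@lebesgue_measure R).-integrable setT (fun t => (Normc.normc (psi t))%:E).
  apply/integrableP; split; first exact/measurable_EFinP.
  by under eq_integral do rewrite gee0_abs ?lee_fin ?normc_ge0// normpsi.
have normc_ge_parts (z : R[i]) : `|complex.Re z| <= Normc.normc z /\
    `|complex.Im z| <= Normc.normc z.
  rewrite -(ger0_norm (normc_ge0 z)) -!sqrtr_sqr sqr_normc.
  by split; rewrite ler_sqrt ?addr_ge0 ?sqr_ge0// (lerDl, lerDr) sqr_ge0.
have ipsir : (@lebesgue_measure R).-integrable setT (fun t => (complex.Re (psi t))%:E).
  apply: (le_integrable measurableT _ _ ipsi); first exact/measurable_EFinP.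
  move=> t _; rewrite /= lee_fin (ger0_norm (normc_ge0 _)).
  by have [] := normc_ge_parts (psi t).
have ipsii : (@lebesgue_measure R).-integrable setT (fun t => (complex.Im (psi t))%:E).
  apply: (le_integrable measurableT _ _ ipsi); first exact/measurable_EFinP.
  move=> t _; rewrite /= lee_fin (ger0_norm (normc_ge0 _)).
  by have [] := normc_ge_parts (psi t).
have phiM t : phi t * (mellin c (cfun f) t * mellin c (cfun g) t) = psi t.
  by rewrite /phi /psi mulrCA -mulrA mulVf ?mulr1// mulrC.
have e0 : 0 < (2 * n%:R)^-1 :> R by rewrite invr_gt0 mulr_gt0// ltr0n.
have mphiiN : measurable_fun setT (fun t => - complex.Im (phi t)) by exact: measurableT_comp.
have phi2N : (\int[@lebesgue_measure R]_t (complex.Re (phi t) ^+ 2)%:E +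
    \int[@lebesgue_measure R]_t ((- complex.Im (phi t)) ^+ 2)%:E <= D%:E)%E.
  by under [X in (_ + X)%E]eq_integral do rewrite sqrrN.
pose Mfg t := mellin c (cfun f) t * mellin c (cfun g) t.
have Re_psi t : complex.Re (phi t) * complex.Re (Mfg t) +
    - complex.Im (phi t) * complex.Im (Mfg t) = complex.Re (psi t).
  by rewrite -phiM [RHS]complexRe_mul mulNr.
have Im_psi t : complex.Im (phi t) * complex.Re (Mfg t) +
    complex.Re (phi t) * complex.Im (Mfg t) = complex.Im (psi t).
  by rewrite -phiM [RHS]complexIm_mul addrC.
have phi2C := phi2; rewrite addeC in phi2C.
have [k1 k10 risk1] := component_risk df g_dens Lf g_L1 G0 sigma0 gG fs
  mphir mphiiN phi2N ipsir Re_psi e0.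
have [k2 k20 risk2] := component_risk df g_dens Lf g_L1 G0 sigma0 gG fs
  mphii mphir phi2C ipsii Im_psi e0.
exists (Num.max k1 k2); split; first by rewrite lt_max k10.
move=> k; rewrite ge_max => /andP[k1k k2k] d Omega P Y iidY.
have [mX1 leX1] := risk1 k k1k _ _ P n Y n0 iidY.
have [mX2 leX2] := risk2 k k2k _ _ P n Y n0 iidY.
set X1 := fun w => _ in mX1 leX1; set X2 := fun w => _ in mX2 leX2.
set I1 := Rintegral _ _ _ in leX1; set I2 := Rintegral _ _ _ in leX2.
have errE w : Normc.normc (theta_hat c Psi g k (fun j => Y j w) - theta c Psi f) ^+ 2 =
    (2 * pi)^-1 ^+ 2 * ((X1 w - I1) ^+ 2 + (X2 w - I2) ^+ 2).
  rewrite /theta_hat /theta -mulrBr Normc.normcM exprMn !sqr_normc/= expr0n/= addr0.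
  congr (_ * ((_ - _) ^+ 2 + (_ - _) ^+ 2)).
    apply: eq_Rintegral => t _.
    by rewrite mulrCA mulrC -/(phi t) complexRe_mul mulNr.
  apply: eq_Rintegral => t _.
  by rewrite mulrCA mulrC -/(phi t) complexIm_mul addrC.
rewrite unlock; under eq_integral do rewrite errE.
(* The prefactor [(2 pi)^-2] is at most 1 and is dropped. *)
apply: (@le_trans _ _ (\int[P]_w ((X1 w - I1) ^+ 2)%:E + \int[P]_w ((X2 w - I2) ^+ 2)%:E)%E).
  have mE (X : Omega -> R) x : measurable_fun setT X ->
      measurable_fun setT (fun w => ((X w - x) ^+ 2)%:E).
    by move=> mX; apply/measurable_EFinP/measurable_funX; exact: measurable_funB.
  rewrite -ge0_integralD//; last 4 first.
  - by move=> w _; rewrite lee_fin sqr_ge0.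
  - exact: mE.
  - by move=> w _; rewrite lee_fin sqr_ge0.
  - exact: mE.
  apply: ge0_le_integral => //.
  - by move=> w _; rewrite lee_fin mulr_ge0 ?addr_ge0 ?sqr_ge0.
  - apply/measurable_EFinP/measurable_funM => //.
    by apply: measurable_funD; apply/measurable_EFinP; exact: mE.
  - by apply: emeasurable_funD; exact: mE.
  move=> w _; rewrite -EFinD lee_fin ler_piMl ?addr_ge0 ?sqr_ge0//.
  rewrite expr_le1// ?invr_ge0 ?mulr_ge0 ?pi_ge0//.
  rewrite invf_le1 ?mulr_gt0 ?pi_gt0//.
  by have := pi_ge2 R; lra.
apply: (le_trans (leeD leX1 leX2)).
rewrite -EFinD lee_fin le_eqVlt; apply/orP; left; apply/eqP.
rewrite /v (ger0_norm sigma0); field.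
by rewrite pnatr_eq0 -lt0n.
Qed.
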